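(* Let $Q$ be a finite quiver with vertex set $I$, and let $\mathfrak{X}$ denote any one of the three stacks $\mathfrak{M}$, $\mathfrak{M}^{\mathrm{doub}}$, $\mathfrak{M}^{\mathrm{trip}}$ described in the context, with the torus $\mathsf{T}=\mathsf{A}\times\mathbb{C}^\times_\hbar$ acting. Set $V(\alpha)\coloneqq K_{\mathsf{T}}(\mathfrak{X}(\alpha))$ and $V\coloneqq\bigoplus_\alpha V(\alpha)$. Then $V$ carries the structure of a braided multiplicative vertex $\mathbf{k}_{\mathsf{T}}$-coalgebra (graded by dimension vectors) whose vertex coproduct has components \[ \mathcal{Y}_{\alpha,\beta}(z)\colon K_{\mathsf{T}}(\mathfrak{X}(\alpha+\beta)) \to K_{\mathsf{T}}(\mathfrak{X}(\alpha))\otimes_{\mathbf{k}_{\mathsf{T}}} K_{\mathsf{T}}(\mathfrak{X}(\beta))(\!(z^{-1})\!),\qquad \mathcal{E}\mapsto \Theta^\bullet_{\alpha,\beta}(z)\otimes z^{\deg_1}\Phi^*_{\alpha,\beta}\mathcal{E}, \] where $\Theta^\bullet_{\alpha,\beta}(z)\coloneqq\wedge^\bullet_{-z}(\mathcal{E}_{\alpha,\beta}^\vee)$ is expanded around $z\to\infty$; and whose remaining data are: the covacuum $\mathbf{1}^\vee$ equal to the identity map $V(0)=\mathbf{k}_{\mathsf{T}}\to\mathbf{k}_{\mathsf{T}}$ and zero on $V(\alpha)$ for $\alpha\neq0$; the translation operator $D(z)\coloneqq z^{\deg}$; and the braiding $\check S_{\alpha,\beta}(z)\coloneqq S_{\beta,\alpha}(z)\circ(12)\colon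 V(\alpha)\otimes V(\beta)\to V(\beta)\otimes V(\alpha)(\!(z^{-1})\!)$, where $(12)$ swaps the tensor factors and $S_{\beta,\alpha}(z)$ is multiplication by $\Theta^\bullet_{\beta,\alpha}(z)/(12)^*\Theta^\bullet_{\alpha,\beta}(z^{-1})$, with $\Theta^\bullet_{\alpha,\beta}(z^{-1})$ also expanded around $z\to\infty$.
   Context: Quiver moduli. For a dimension vector $\alpha\in\mathbb{Z}_{\ge0}^I$ let $M(\alpha)=\prod_{e\colon i\to j}\mathrm{Hom}(\mathbb{C}^{\alpha_i},\mathbb{C}^{\alpha_j})$ (product over edges of $Q$), $\mathrm{GL}(\alpha)=\prod_i\mathrm{GL}(\alpha_i)$, $\mathfrak{gl}(\alpha)=\prod_i\mathrm{End}(\mathbb{C}^{\alpha_i})$, and $\mathfrak{M}(\alpha)=[M(\alpha)/\mathrm{GL}(\alpha)]$; $\mathfrak{M}(0)=\mathrm{pt}$. The doubled quiver $Q^{\mathrm{doub}}$ adds an edge $e^*\colon j\to i$ for each edge $e\colon i\to j$; the tripled quiver $Q^{\mathrm{trip}}$ further adds a loop at each vertex. Thus $\mathfrak{M}^{\mathrm{doub}}(\alpha)=[T^*M(\alpha)/\mathrm{GL}(\alpha)]$ and $\mathfrak{M}^{\mathrm{trip}}(\alpha)=[T^*M(\alpha)\times\mathfrak{gl}(\alpha)/\mathrm{GL}(\alpha)]$. The torus $\mathsf{A}=(\mathbb{C}^\times)^{\#\text{edges of }Q}$ scales the edge maps of $Q$ (write $a_e$ for the character attached to edge $e$), and $\mathsf{T}=\mathsf{A}\times\mathbb{C}^\times_\hbar$,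 where $\mathbb{C}^\times_\hbar$ acts trivially on $M(\alpha)$, scales the cotangent directions so that the symplectic form on $T^*M(\alpha)$ has weight $\hbar$, and scales $\mathfrak{gl}(\alpha)$ with weight $\hbar^{-1}$. Accordingly each edge $e\colon i\to j$ of the relevant quiver carries a $\mathsf{T}$-weight $w_e$: $w_e=a_e$ for edges of $Q$, $w_{e^*}=\hbar a_e^{-1}$ for dual edges, and $w=\hbar^{-1}$ for the added loops. K-theory. $\mathbf{k}_{\mathsf{T}}=K_{\mathsf{T}}(\mathrm{pt})$ is the representation ring of $\mathsf{T}$. For a quotient stack $[X/G]$ with a commuting $\mathsf{T}$-action, $K_{\mathsf{T}}([X/G])\coloneqq K_{\mathsf{T}\times G}(X)$, the Grothendieck group of the derived category of $(\mathsf{T}\times G)$-equivariant coherent sheaves. Here $K_{\mathsf{T}}(\mathfrak{X}(\alpha))\cong\mathbf{k}_{\mathsf{T}}[s_{\alpha,i,j}^{\pm1}: i\in I,1\le j\le\alpha_i]^{S(\alpha)}$ with $S(\alpha)=\prod_iS_{\alpha_i}$ permuting the $s_{\alpha,i,j}$ for fixed $i$; the tautological bundle at vertex $i$ is $\mathcal{V}_{\alpha,i}=\sum_js_{\alpha,i,j}$. One has $K_{\mathsf{T}}(\mathfrak{X}(\alpha)\times\mathfrak{X}(\beta))\cong K_{\mathsf{T}}(\mathfrak{X}(\alpha))\otimes_{\mathbf{k}_{\mathsf{T}}}K_{\mathsf{T}}(\mathfrak{X}(\beta))$. For a vector bundle $\mathcal{E}$, $\wedge^\bullet_{-z}(\mathcal{E})=\sum_i(-z)^i\wedge^i\mathcal{E}$,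 extended multiplicatively to K-theory classes by $\wedge^\bullet_{-z}(\mathcal{E}-\mathcal{E}')=\wedge^\bullet_{-z}(\mathcal{E})/\wedge^\bullet_{-z}(\mathcal{E}')$; via K-theoretic Chern roots it is $\prod(1-z\mathcal{L}_+^\vee)\prod(1-z\mathcal{L}_-^\vee)^{-1}$, and ''expanded around $z\to\infty$'' means each factor $(1-z\mathcal{L})^{-1}$ is expanded as $-\sum_{k>0}z^{-k}\mathcal{L}^{-k}$. Structure maps. $\Phi_{\alpha,\beta}\colon\mathfrak{X}(\alpha)\times\mathfrak{X}(\beta)\to\mathfrak{X}(\alpha+\beta)$ is the direct sum map; on K-theory, $\Phi^*_{\alpha,\beta}$ is the inclusion of symmetric Laurent polynomials sending $s_{\alpha+\beta,i,j}\mapsto s_{\alpha,i,j}$ for $j\le\alpha_i$ and $s_{\alpha+\beta,i,j}\mapsto s_{\beta,i,j-\alpha_i}$ for $j>\alpha_i$. The scaling automorphism $\Psi_\alpha\colon[\mathrm{pt}/\mathbb{C}^\times]\times\mathfrak{X}(\alpha)\to\mathfrak{X}(\alpha)$ (identity on points, $(\lambda,f)\mapsto\lambda f$ on stabilizers) induces a grading: $\Psi_\alpha^*\mathcal{E}=\bigoplus_k\mathcal{L}^k\boxtimes\mathcal{E}_k$ gives $\deg\mathcal{E}_k=k$; concretely $z^{\deg}h=h|_{s_{\alpha,i,j}\mapsto zs_{\alpha,i,j}}$. On a product, $\deg_1$ (resp. $\deg_2$) is the grading from the first (resp. second) factor. The bilinear element on $\mathfrak{X}(\alpha)\times\mathfrak{X}(\beta)$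 is the K-theory class $\mathcal{E}_{\alpha,\beta}=\sum_{e\colon i\to j}w_e\,\mathcal{V}_{\alpha,i}^\vee\boxtimes\mathcal{V}_{\beta,j}-\sum_{i\in I}\mathcal{V}_{\alpha,i}^\vee\boxtimes\mathcal{V}_{\beta,i}$, the first sum over edges of $Q$, $Q^{\mathrm{doub}}$ or $Q^{\mathrm{trip}}$ according as $\mathfrak{X}=\mathfrak{M},\mathfrak{M}^{\mathrm{doub}},\mathfrak{M}^{\mathrm{trip}}$. Braided multiplicative vertex coalgebra over a commutative ring $R$: an $R$-module $V=\bigoplus_\alpha V(\alpha)$ (graded by dimension vectors, all operators preserving the grading; $V^*$ is the restricted dual) with a covacuum $\mathbf{1}^\vee\in V^*$, a translation operator $D(z)\colon V\to V[z^{\pm1}]$ with $D(z)D(w)=D(zw)$, a vertex coproduct $\mathcal{Y}(z)\colon V\to V\otimes V(\!(z^{-1})\!)$, and a braiding $\check S(z)\colon V\otimes V\to V\otimes V(\!(z^{-1})\!)$ with $\check S(z^{-1})\check S(z)=\mathrm{id}$, satisfying: (covacuum) $(\mathbf{1}^\vee\otimes\mathrm{id})\mathcal{Y}(z)=\mathrm{id}$, $(\mathrm{id}\otimes\mathbf{1}^\vee)\mathcal{Y}(z)a\in V[z^{\pm1}]$ with $(\mathrm{id}\otimes\mathbf{1}^\vee)\mathcal{Y}(1)a=a$, and $(\mathbf{1}^\vee\otimes\mathrm{id})\check S(z)=\mathrm{id}\otimes\mathbf{1}^\vee$; (skew symmetry) $\check S(z^{-1})\mathcal{Y}(z)=\mathcal{Y}(z^{-1})D(z)$,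 the left side being well-defined; (weak coassociativity) $(\mathcal{Y}(z)\otimes\mathrm{id})\mathcal{Y}(w)\equiv(\mathrm{id}\otimes\mathcal{Y}(w))\mathcal{Y}(zw)$, where $\equiv$ means that after applying any $f\otimes g\otimes h\in(V^* )^{\otimes3}$ both sides lie in and are equal in $V^*[\![z^{-1},w^{-1}]\!][z,w]$; (Yang–Baxter) $(\check S(z)\otimes\mathrm{id})(\mathrm{id}\otimes\check S(zw))(\check S(w)\otimes\mathrm{id})\equiv(\mathrm{id}\otimes\check S(w))(\check S(zw)\otimes\mathrm{id})(\mathrm{id}\otimes\check S(z))$ and $(\mathcal{Y}(z)\otimes\mathrm{id})\check S(w)\equiv(\mathrm{id}\otimes\check S(w))(\check S(zw)\otimes\mathrm{id})(\mathrm{id}\otimes\mathcal{Y}(z))$.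
   Formalization: Š(z^{-1}) and Y(z^{-1}) in the axioms are read as the same expressions with z replaced by z^{-1} and re-expanded around z→∞ (plain substitution makes skew symmetry fail); the wedge class uses Σ(-z)^i∧^i, i.e. factors (1-zL) over the Chern roots L of the dual of E. *)

(* Defs.v *)
(* (+ multinomials' monoid algebras [monalg] and finmap).

   Concrete model of the statement:
   * all K-theory rings are realised, via the presentation given in the
     context, inside ONE Laurent polynomial ring  [Lp]  over [int] in the
     variables  a_e (e : E), hbar, and  s_{b,i,j}  (block b, vertex i, index j);
     Laurent monomials are [mon] (finitely supported exponent vectors
     var -> int), and [Lp] = finitely supported functions mon -> int.
   * K_T(pt) = k_T  = elements using only torus variables  ([kT]);
     K_T(X(a1)) (x) ... (x) K_T(X(ar)) (tensor over k_T)
       = S(a1) x ... x S(ar)-invariant Laurent polynomials whose s-variables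
         are s_{b,i,j} with b < r, j < a_b i            ([Vt [:: a1; ..; ar]]);
     the tensor factor number b uses the block-b variables.
   * formal series in two formal variables z, w :  [ser] = int -> int -> Lp,
     [X n m] = coefficient of z^n w^m.                                       *)
From HB Require Import structures.
From mathcomp Require Import all_boot all_algebra.
From mathcomp Require Import finmap.
From mathcomp.multinomials Require Import monalg.
From Stdlib Require Import ClassicalEpsilon.

Set Implicit Arguments.
Unset Strict Implicit.
Unset Printing Implicit Defensive.

Import GRing.Theory.
Local Open Scope ring_scope.

Inductive kind := KM | KDoub | KTrip.

Section Model.
Variables (I E : finType) (src tgt : E -> I).

Definition var := ((E + unit) + (nat * I * nat))%type.
Definition av (e : E) : var := inl (inl e).
Definition hv : var := inl (inr tt).
Definition sv (b : nat) (i : I) (j : nat) : var := inr (b, i, j).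

Definition mon := {malg int[var]}.        (* Laurent monomials, written additively *)
Definition mvar (v : var) : mon := << v >>.

Definition Lp := {malg int[mon]}.
Definition lmon (k : mon) : Lp := << k >>.
Definition lone : Lp := lmon 0.
Definition lmul (f g : Lp) : Lp :=
  \sum_(k1 <- msupp f) \sum_(k2 <- msupp g) << f@_k1 * g@_k2 *g (k1 + k2) >>.

Definition mren (r : var -> var) (k : mon) : mon :=
  \sum_(v <- msupp k) << k@_v *g r v >>.
Definition lren (r : var -> var) (f : Lp) : Lp :=
  \sum_(k <- msupp f) << f@_k *g mren r k >>.

(* grading of the b-th tensor factor: total degree in the block-b variables *)
Definition isblk (b : nat) (v : var) : bool :=
  if v is inr (b', _, _) then b' == b else false.
Definition bdeg (b : nat) (k : mon) : int := \sum_(v <- msupp k | isblk b v) k@_v.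
Definition lhom (b : nat) (d : int) (f : Lp) : Lp :=
  \sum_(k <- msupp f | bdeg b k == d) << f@_k *g k >>.

Definition okvar (ds : seq (I -> nat)) (v : var) : bool :=
  if v is inr (b, i, j) then (b < size ds)%N && (j < nth (fun=> 0%N) ds b i)%N
  else true.
Definition swapidx (b : nat) (i : I) (j j' : nat) (v : var) : var :=
  if v is inr (b', i', j'') then
    if (b' == b) && (i' == i) then
      (if j'' == j then sv b i j' else if j'' == j' then sv b i j else v)
    else v
  else v.
Definition Vt (ds : seq (I -> nat)) (x : Lp) : Prop :=
  (forall k, k \in msupp x -> forall v, v \in msupp k -> okvar ds v) /\
  (forall b i j j', (b < size ds)%N ->
     (j < nth (fun=> 0%N) ds b i)%N -> (j' < nth (fun=> 0%N) ds b i)%N ->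
     lren (swapidx b i j j') x = x).
Definition kT (x : Lp) : Prop := Vt [::] x.

Definition dv0 : I -> nat := fun=> 0%N.
Definition dvadd (a b : I -> nat) : I -> nat := fun i => (a i + b i)%N.

Definition ser := int -> int -> Lp.
(* sum of a finitely supported family (junk if not finitely supported) *)
Definition fsum (f : int -> Lp) : Lp :=
  let s := epsilon (inhabits [::]) (fun s : seq int => forall d, d \notin s -> f d = 0) in
  \sum_(d <- undup s) f d.
Definition smul (S T : ser) : ser := fun n m =>
  fsum (fun k => fsum (fun l => lmul (S k l) (T (n - k) (m - l)))).
Definition sconst (x : Lp) : ser := fun n m => if (n == 0) && (m == 0) then x else 0.
Definition sprod (s : seq ser) : ser := foldr smul (sconst lone) s.
(* support bounded above in both exponents: element of  Lp[[z^-1,w^-1]][z,w] *)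
Definition bdd (X : ser) : Prop :=
  exists N M : int, forall n m, (N < n) || (M < m) -> X n m = 0.
Definition ser1 (X : ser) : Prop := forall n m, m != 0 -> X n m = 0.
Definition lpoly1 (X : ser) : Prop :=
  exists N : int, forall n m, (N < `|n|) || (m != 0) -> X n m = 0.
Definition sadd (X Y : ser) : ser := fun n m => X n m + Y n m.
Definition sscal (r : Lp) (X : ser) : ser := fun n m => lmul r (X n m).

(* formal variables zeta = z^p w^q, encoded by (p, q) *)
Definition zZ : int * int := (1, 0).
Definition zZi : int * int := (-1, 0).
Definition zW : int * int := (0, 1).
Definition zZW : int * int := (1, 1).
Definition zinv (z : int * int) : int * int := (- z.1, - z.2).

(* (1 - zeta r)^{+1} resp. ^{-1}, expanded around z,w -> oo, for
   zeta in {z, w, zw} ("large") or {z^-1, w^-1, (zw)^-1} ("small"):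
     (1 - zeta r)^-1 = - sum_{k>0} zeta^-k r^-k  (large zeta),
                     =   sum_{k>=0} zeta^k r^k   (small zeta).          *)
Definition fac (z : int * int) (r : mon) (pos : bool) : ser := fun n m =>
  let k := if z.1 != 0 then n * z.1 else m * z.2 in
  if (n != k * z.1) || (m != k * z.2) then 0 else
  if pos then (if k == 0 then lone else if k == 1 then - lmon r else 0)
  else if 0 < z.1 + z.2 then (if k < 0 then - lmon (r *~ k) else 0)
  else (if 0 <= k then lmon (r *~ k) else 0).

(* wedge^._{-zeta}(F) for the K-theory class F = sum of (+/-) Chern roots
   (a list of (root, sign)), i.e. prod (1 - zeta L_+) prod (1 - zeta L_-)^{-1},
   expanded around infinity *)
Definition lam (z : int * int) (rs : seq (mon * bool)) : ser :=
  sprod [seq fac z r.1 r.2 | r <- rs].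
Definition negcl (rs : seq (mon * bool)) : seq (mon * bool) :=
  [seq (r.1, ~~ r.2) | r <- rs].

(* weighted edges (source, target, T-weight) of Q, Q^doub or Q^trip *)
Definition wedges (kd : kind) : seq (I * I * mon) :=
  [seq (src e, tgt e, mvar (av e)) | e <- enum E] ++
  (if kd is KM then [::]
   else [seq (tgt e, src e, mvar hv - mvar (av e)) | e <- enum E]) ++
  (if kd is KTrip then [seq (i, i, - mvar hv) | i <- enum I] else [::]).

(* Chern roots (with signs) of  E_{a,b}^dual,  a in block b1, b in block b2:
   E_{a,b} = sum_e w_e V_{a,i}^v V_{b,j} - sum_i V_{a,i}^v V_{b,i}          *)
Definition Eroots (kd : kind) (a b : I -> nat) (b1 b2 : nat) : seq (mon * bool) :=
  flatten [seq flatten [seq [seq (mvar (sv b1 t.1.1 x) - mvar (sv b2 t.1.2 y) - t.2, true)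
                            | y <- iota 0 (b t.1.2)] | x <- iota 0 (a t.1.1)]
          | t <- wedges kd]
  ++ flatten [seq flatten [seq [seq (mvar (sv b1 i x) - mvar (sv b2 i y), false)
                              | y <- iota 0 (b i)] | x <- iota 0 (a i)]
             | i <- enum I].

Definition Theta kd (z : int * int) a b b1 b2 : ser := lam z (Eroots kd a b b1 b2).

(* S_{b,a}(zeta) = Theta_{b,a}(zeta) / (12)^* Theta_{a,b}(zeta^-1),
   on blocks p (factor V(b)) and p+1 (factor V(a)) *)
Definition Sser kd (z : int * int) a b (p : nat) : ser :=
  smul (lam z (Eroots kd b a p p.+1)) (lam (zinv z) (negcl (Eroots kd a b p.+1 p))).

Definition renS (r : var -> var) (X : ser) : ser := fun n m => lren r (X n m).
(* zeta^{deg_b} : scale the b-th tensor factor *)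
Definition scaleS (b : nat) (z : int * int) (X : ser) : ser := fun n m =>
  fsum (fun d => lhom b d (X (n - d * z.1) (m - d * z.2))).
Definition vmap (fb : nat -> nat) (v : var) : var :=
  if v is inr (b, i, j) then sv (fb b) i j else v.
(* Phi^*_{a,_} on tensor factor p (factor p splits into p, p+1; later ones shift) *)
Definition rsplit (p : nat) (a : I -> nat) (v : var) : var :=
  if v is inr (b, i, j) then
    if (b < p)%N then v
    else if b == p then (if (j < a i)%N then v else sv p.+1 i (j - a i))
    else sv b.+1 i j
  else v.
Definition rswap (p : nat) : var -> var :=
  vmap (fun b => if b == p then p.+1 else if b == p.+1 then p else b).

Definition Yop kd (p : nat) (a b : I -> nat) (z : int * int) (X : ser) : ser :=
  smul (Theta kd z a b p p.+1) (scaleS p z (renS (rsplit p a) X)).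
Definition Sop kd (p : nat) (a b : I -> nat) (z : int * int) (X : ser) : ser :=
  smul (Sser kd z a b p) (renS (rswap p) X).
Definition Dop (z : int * int) (X : ser) : ser := scaleS 0 z X.
(* 1^v (x) id : V(0) (x) V(a) = k_T (x) V(a) -> V(a) *)
Definition dropfirst (X : ser) : ser := renS (vmap predn) X.

Definition linfun (a : I -> nat) (f : Lp -> Lp) : Prop :=
  (forall x, Vt [:: a] x -> kT (f x)) /\
  (forall r x y, kT r -> Vt [:: a] x -> Vt [:: a] y ->
     f (lmul r x + y) = lmul r (f x) + f y).
Definition up (b : nat) : var -> var := vmap (fun c => (c + b)%N).
Definition decomp3 (a1 a2 a3 : I -> nat) (x : Lp) (t : seq (Lp * Lp * Lp)) : Prop :=
  (forall u, u \in t -> [/\ Vt [:: a1] u.1.1, Vt [:: a2] u.1.2 & Vt [:: a3] u.2]) /\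
  x = \sum_(u <- t) lmul u.1.1 (lmul (lren (up 1) u.1.2) (lren (up 2) u.2)).
Definition tens3 (a1 a2 a3 : I -> nat) (f g h : Lp -> Lp) (x : Lp) : Lp :=
  let t := epsilon (inhabits [::]) (decomp3 a1 a2 a3 x) in
  \sum_(u <- t) lmul (f u.1.1) (lmul (g u.1.2) (h u.2)).
Definition weq3 (a1 a2 a3 : I -> nat) (X Y : ser) : Prop :=
  forall f g h, linfun a1 f -> linfun a2 g -> linfun a3 h ->
    let F : ser := fun n m => tens3 a1 a2 a3 f g h (X n m) in
    let G : ser := fun n m => tens3 a1 a2 a3 f g h (Y n m) in
    [/\ bdd F, bdd G & F = G].

Definition Y_welldef kd : Prop :=
  forall a b, (forall x, Vt [:: dvadd a b] x ->
      let X := Yop kd 0 a b zZ (sconst x) in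
      [/\ ser1 X, bdd X & forall n m, Vt [:: a; b] (X n m)]) /\
    (forall r x y, kT r -> Vt [:: dvadd a b] x -> Vt [:: dvadd a b] y ->
      Yop kd 0 a b zZ (sconst (lmul r x + y)) =
      sadd (sscal r (Yop kd 0 a b zZ (sconst x))) (Yop kd 0 a b zZ (sconst y))).

Definition S_welldef kd : Prop :=
  forall a b, (forall x, Vt [:: a; b] x ->
      let X := Sop kd 0 a b zZ (sconst x) in
      [/\ ser1 X, bdd X & forall n m, Vt [:: b; a] (X n m)]) /\
    (forall r x y, kT r -> Vt [:: a; b] x -> Vt [:: a; b] y ->
      Sop kd 0 a b zZ (sconst (lmul r x + y)) =
      sadd (sscal r (Sop kd 0 a b zZ (sconst x))) (Sop kd 0 a b zZ (sconst y))).

Definition D_welldef : Prop :=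
  forall a, (forall x, Vt [:: a] x ->
      let X := Dop zZ (sconst x) in
      [/\ lpoly1 X, forall n m, Vt [:: a] (X n m)
        & Dop zZ (Dop zW (sconst x)) = Dop zZW (sconst x)]) /\
    (forall r x y, kT r -> Vt [:: a] x -> Vt [:: a] y ->
      Dop zZ (sconst (lmul r x + y)) =
      sadd (sscal r (Dop zZ (sconst x))) (Dop zZ (sconst y))).

Definition S_unitary kd : Prop :=
  forall a b x, Vt [:: a; b] x ->
    Sop kd 0 b a zZi (Sop kd 0 a b zZ (sconst x)) = sconst x.

Definition covacuum kd : Prop :=
  (forall a x, Vt [:: a] x -> dropfirst (Yop kd 0 dv0 a zZ (sconst x)) = sconst x) /\
  (forall a x, Vt [:: a] x ->
     let X := Yop kd 0 a dv0 zZ (sconst x) in lpoly1 X /\ fsum (fun n => X n 0) = x) /\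
  (forall a x, Vt [:: a; dv0] x ->
     dropfirst (Sop kd 0 a dv0 zZ (sconst x)) = sconst x).

Definition skew_symmetry kd : Prop :=
  forall a b x, Vt [:: dvadd a b] x ->
    Sop kd 0 a b zZi (Yop kd 0 a b zZ (sconst x)) =
    Yop kd 0 b a zZi (Dop zZ (sconst x)).

Definition weak_coassoc kd : Prop :=
  forall a b c x, Vt [:: dvadd (dvadd a b) c] x ->
    weq3 a b c (Yop kd 0 a b zZ (Yop kd 0 (dvadd a b) c zW (sconst x)))
               (Yop kd 1 b c zW (Yop kd 0 a (dvadd b c) zZW (sconst x))).

Definition yang_baxter kd : Prop :=
  forall a b c x, Vt [:: a; b; c] x ->
    weq3 c b a (Sop kd 0 b c zZ (Sop kd 1 a c zZW (Sop kd 0 a b zW (sconst x))))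
               (Sop kd 1 a b zW (Sop kd 0 a c zZW (Sop kd 1 b c zZ (sconst x)))).

Definition yang_baxter_Y kd : Prop :=
  forall g d1 d2 x, Vt [:: g; dvadd d1 d2] x ->
    weq3 d1 d2 g (Yop kd 0 d1 d2 zZ (Sop kd 0 g (dvadd d1 d2) zW (sconst x)))
                 (Sop kd 1 g d2 zW (Sop kd 0 g d1 zZW (Yop kd 1 d1 d2 zZ (sconst x)))).

Definition braided_mult_vertex_coalgebra kd : Prop :=
  Y_welldef kd /\ S_welldef kd /\ D_welldef /\ S_unitary kd /\ covacuum kd /\
  skew_symmetry kd /\ weak_coassoc kd /\ yang_baxter kd /\ yang_baxter_Y kd.

End Model.

(* Main.v *)
(** Every composite of vertex coproducts, braidings and translations applied to a symmetric
    Laurent polynomial x has the form (product of factors (1 - zeta r)^{+1, -1}) * (x with its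
    variables replaced by monomials in z, w and the variables). All these products live among
    the series bounded above in both exponents, where multiplication is associative and
    commutative, and renaming a variable or scaling a tensor factor acts on both parts through
    a group endomorphism of Z^2 x (monomials). So each axiom reduces to an equality of
    multisets of Chern roots, which follows from the bilinearity of E_{a,b} (up to cancelling
    a factor against its inverse), and to an equality of substitutions on variables, up to a
    permutation that x does not see in the case of skew symmetry. *)
Require Import Defs.
From HB Require Import structures.
From mathcomp Require Import all_boot all_order all_algebra.
From mathcomp Require Import fingroup perm finmap zify.
From mathcomp.multinomials Require Import monalg.
From Stdlib Require Import ClassicalEpsilon FunctionalExtensionality.

Set Implicit Arguments.
Unset Strict Implicit.
Unset Printing Implicit Defensive.

Import GRing.Theory Num.Theory Order.TTheory.
Local Open Scope ring_scope.

(** * Finitely supported sums *)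

Section FiniteSums.
Variables (T : eqType) (W : zmodType).
Implicit Types f g : T -> W.

Definition covers (s : seq T) f := forall x, x \notin s -> f x = 0.
Definition finsup f := exists s, covers s f.
(** The sum [fsum] of the model with arbitrary index type and group ([fsumE] holds by conversion),
    so that iterated sums can be merged into one sum over pairs. *)
Definition fs f : W :=
  \sum_(x <- undup (epsilon (inhabits [::]) (fun s => covers s f))) f x.

(** Dropping the zeros leaves exactly the support of [f] in both lists; hence the value of [fs] does
    not depend on the list that epsilon selects. *)
Lemma covers_sum s t f : uniq s -> uniq t -> covers s f -> covers t f ->
  \sum_(x <- s) f x = \sum_(x <- t) f x.
Proof.
move=> us ut cs ct.
have nz (r : seq T) : \sum_(x <- r) f x = \sum_(x <- [seq x <- r | f x != 0]) f x.
  rewrite big_filter [RHS]big_mkcond; apply: eq_bigr => x _.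
  by case: eqP => //= ->.
rewrite nz [RHS]nz; apply: perm_big; apply: uniq_perm; rewrite ?filter_uniq //.
move=> x; rewrite !mem_filter; case: eqP => //= fx.
have -> : x \in s by apply/negPn/negP => /cs.
by symmetry; apply/negPn/negP => /ct.
Qed.

Lemma fsE s f : uniq s -> covers s f -> fs f = \sum_(x <- s) f x.
Proof.
move=> us cs; rewrite /fs; apply: covers_sum => //; first exact: undup_uniq.
move=> x; rewrite mem_undup; move: x.
by apply: (epsilon_spec (inhabits [::]) (fun s0 => covers s0 f)); exists s.
Qed.

Lemma covers_undup s f : covers s f -> covers (undup s) f.
Proof. by move=> c x; rewrite mem_undup; apply: c. Qed.

Lemma fs_eq f g : f =1 g -> fs f = fs g.
Proof. by move=> /functional_extensionality ->. Qed.

Lemma fs0 f : (forall x, f x = 0) -> fs f = 0.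
Proof. by move=> f0; rewrite (@fsE [::]) ?big_nil. Qed.

Lemma fs_single x0 f : (forall x, x != x0 -> f x = 0) -> fs f = f x0.
Proof.
move=> h; rewrite (@fsE [:: x0]) ?big_seq1 //.
by move=> x; rewrite inE; apply: h.
Qed.

Lemma fsD f g : finsup f -> finsup g -> fs (fun x => f x + g x) = fs f + fs g.
Proof.
move=> [s cs] [t ct].
have cf : covers (undup (s ++ t)) f.
  by move=> x; rewrite mem_undup mem_cat negb_or => /andP[/cs].
have cg : covers (undup (s ++ t)) g.
  by move=> x; rewrite mem_undup mem_cat negb_or => /andP[_ /ct].
rewrite (fsE (undup_uniq _) cf) (fsE (undup_uniq _) cg) -big_split /=.
by apply: fsE; rewrite ?undup_uniq // => x h; rewrite cf ?cg ?addr0.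
Qed.

End FiniteSums.

Lemma fs_morph (T : eqType) (W W' : zmodType) (h : W -> W') (f : T -> W) :
  {morph h : x y / x + y} -> finsup f -> h (fs f) = fs (h \o f).
Proof.
move=> hD [s cs].
have h0 : h 0 = 0 by apply: (@addIr _ (h 0)); rewrite -hD !add0r.
rewrite (fsE (undup_uniq s) (covers_undup cs)) (big_morph h hD h0).
by rewrite (fsE (undup_uniq s)) // => x /(covers_undup cs) /= ->.
Qed.

Lemma fs_reindex (T T' : eqType) (W : zmodType) (h : T' -> T) (k : T -> T') (f : T -> W) :
  cancel h k -> cancel k h -> finsup f -> fs (f \o h) = fs f.
Proof.
move=> hk kh [s cs].
rewrite (fsE (undup_uniq s) (covers_undup cs)).
rewrite (@fsE _ _ [seq k x | x <- undup s]).
- by rewrite big_map; apply: eq_bigr => x _ /=; rewrite kh.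
- by rewrite map_inj_uniq ?undup_uniq //; apply: can_inj kh.
- move=> x nx /=; apply: cs; apply: contra nx => xs.
  by rewrite -[x]hk map_f // mem_undup.
Qed.

Lemma fs_pair (T T' : eqType) (W : zmodType) (f : T * T' -> W) :
  finsup f -> fs (fun x => fs (fun y => f (x, y))) = fs f.
Proof.
move=> [s cs].
set s1 := undup [seq p.1 | p <- s]; set s2 := undup [seq p.2 | p <- s].
have c2 x : covers s2 (fun y => f (x, y)).
  move=> y; rewrite mem_undup => ny; apply: cs; apply: contra ny => h.
  by apply/mapP; exists (x, y).
rewrite (@fsE _ _ s1); first last.
- move=> x; rewrite mem_undup => nx; apply: fs0 => y; apply: cs; apply: contra nx => h.
  by apply/mapP; exists (x, y).
- exact: undup_uniq.
rewrite (@fsE _ _ [seq (x, y) | x <- s1, y <- s2]).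
- rewrite big_allpairs; apply: eq_bigr => x _.
  by rewrite (fsE (undup_uniq _) (c2 x)).
- by apply: allpairs_uniq; rewrite ?undup_uniq // => -[? ?] [? ?].
- move=> [x y] nxy; apply: cs; apply: contra nxy => h.
  by apply/allpairsP; exists (x, y); rewrite !mem_undup; split=> //=; apply/mapP; exists (x, y).
Qed.

Lemma fs_exchange (T T' : eqType) (W : zmodType) (f : T -> T' -> W) :
  finsup (fun p => f p.1 p.2) ->
  fs (fun x => fs (f x)) = fs (fun y => fs (f^~ y)).
Proof.
move=> h; rewrite (fs_pair h).
rewrite -(fs_reindex (h := fun p => (p.2, p.1)) (k := fun p => (p.2, p.1)) _ _ h); first last.
- by case.
- by case.
rewrite -fs_pair //; case: h => s cs; exists [seq (p.2, p.1) | p <- s] => -[y x] n /=.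
by apply: (cs (x, y)); apply: contra n => xy; apply/mapP; exists (x, y).
Qed.

Lemma finsup_fiber (T T' : eqType) (W : zmodType) (f : T * T' -> W) (s : seq T) :
  (forall x y, x \notin s -> f (x, y) = 0) ->
  (forall x, finsup (fun y => f (x, y))) -> finsup f.
Proof.
move=> h1 h2.
suff [t ct] : exists t : seq (T * T'), forall x y, x \in s -> (x, y) \notin t -> f (x, y) = 0.
  exists t => -[x y] n; have [xs|xs] := boolP (x \in s); [exact: ct | exact: h1].
elim: s {h1} => [|x0 s [t ct]]; first by exists [::].
have [u cu] := h2 x0; exists ([seq (x0, y) | y <- u] ++ t) => x y.
rewrite inE mem_cat negb_or => /orP[/eqP->|xs] /andP[n1 n2]; last exact: ct.
by apply: cu; apply: contra n1 => yu; apply: map_f.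
Qed.

Lemma finsup_imp (T : eqType) (W W' : zmodType) (f : T -> W) (g : T -> W') :
  (forall x, f x = 0 -> g x = 0) -> finsup f -> finsup g.
Proof. by move=> h [s cs]; exists s => x /cs /h. Qed.

Lemma finsup_comp (T T' : eqType) (W : zmodType) (f : T -> W) (h : T' -> T) k :
  cancel h k -> finsup f -> finsup (f \o h).
Proof.
move=> hk [s cs]; exists (map k s) => x nx /=; apply: cs; apply: contra nx => xs.
by apply/mapP; exists (h x).
Qed.

(** * Linear maps on finitely supported functions *)

(* The operations of the model are transparent sums over finitely supported
   functions, and comparing two distinct instances by conversion unfolds them
   without end; hence the locked copies. *)
HB.lock Definition mU (K : choiceType) (k : K) : {malg int[K]} := << k >>.
HB.lock Definition lin (K : choiceType) (W : zmodType) (f : K -> W) (x : {malg int[K]}) : W :=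
  \sum_(k <- msupp x) f k *~ x@_k.

Lemma malgUE (K : choiceType) (k : K) (c : int) : << c *g k >> = mU k *~ c.
Proof. by rewrite mU.unlock -[c in LHS]intz; rewrite (raddfMz (mkmalgU k)). Qed.

Lemma malgU1E (K : choiceType) (k : K) : << k >> = mU k.
Proof. by rewrite mU.unlock. Qed.

Lemma mU_coef (K : choiceType) (k l : K) : (mU k)@_l = (k == l)%:R.
Proof. by rewrite mU.unlock mcoeffU. Qed.

Section Linear.
Variables (K : choiceType) (W : zmodType).
Implicit Types (f : K -> W) (x y : {malg int[K]}).

Lemma linE (s : seq K) f x : uniq s -> {subset msupp x <= s} ->
  lin f x = \sum_(k <- s) f k *~ x@_k.
Proof.
move=> us sub; rewrite lin.unlock.
apply: (@covers_sum _ _ (msupp x) s (fun k => f k *~ x@_k)) => //.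
- by move=> k nk /=; rewrite mcoeff_outdom ?mulr0z.
- by move=> k nk /=; rewrite mcoeff_outdom ?mulr0z //; apply: contra nk => /sub.
Qed.

Lemma linD f : {morph lin f : x y / x + y}.
Proof.
move=> x y; set s := undup (msupp x ++ msupp y).
have us : uniq s by exact: undup_uniq.
rewrite !(linE f us).
- rewrite -big_split /=; apply: eq_bigr => k _.
  by rewrite mcoeffD mulrzDr.
- by move=> k kx; rewrite mem_undup mem_cat kx orbT.
- by move=> k kx; rewrite mem_undup mem_cat kx.
- move=> k; rewrite mem_undup mem_cat -!mcoeff_neq0 mcoeffD.
  by apply: contraR; rewrite negb_or !negbK => /andP[/eqP-> /eqP->]; rewrite addr0.
Qed.

Lemma lin1 f k : lin f (mU k) = f k.
Proof.
rewrite (@linE [:: k]) ?big_seq1 ?mU_coef ?eqxx //.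
move=> k'; rewrite -mcoeff_neq0 mU_coef inE (eq_sym k').
by case: (k == k').
Qed.

Lemma lin_eq_in f g x : (forall k, k \in msupp x -> f k = g k) -> lin f x = lin g x.
Proof. by rewrite lin.unlock => h; apply: eq_big_seq => k /h ->. Qed.

Lemma lin_addf f g x : lin (fun k => f k + g k) x = lin f x + lin g x.
Proof.
by rewrite !lin.unlock -big_split; apply: eq_bigr => k _; rewrite mulrzDl.
Qed.

End Linear.

Lemma morph0 (V W : zmodType) (h : V -> W) : {morph h : x y / x + y} -> h 0 = 0.
Proof. by move=> hD; apply: (@addIr _ (h 0)); rewrite -hD !add0r. Qed.

Lemma morphN (V W : zmodType) (h : V -> W) : {morph h : x y / x + y} -> {morph h : x / - x}.
Proof.
by move=> hD x; apply: (@addIr _ (h x)); rewrite -hD !addNr (morph0 hD).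
Qed.

Lemma morphB (V W : zmodType) (h : V -> W) : {morph h : x y / x + y} -> {morph h : x y / x - y}.
Proof. by move=> hD x y; rewrite hD (morphN hD). Qed.

Lemma morphz (V W : zmodType) (h : V -> W) n : {morph h : x y / x + y} -> {morph h : x / x *~ n}.
Proof.
move=> hD x.
have hn m : h (x *+ m) = h x *+ m.
  by elim: m => [|m IH]; rewrite ?mulr0n ?(morph0 hD) // !mulrS hD IH.
by case: n => m; rewrite ?NegzE ?mulrNz -?pmulrn ?(morphN hD) hn.
Qed.

Lemma lin_morph (K : choiceType) (W W' : zmodType) (h : W -> W') (f : K -> W) x :
  {morph h : x y / x + y} -> h (lin f x) = lin (h \o f) x.
Proof.
move=> hD; rewrite !lin.unlock (big_morph h hD (morph0 hD)).
by apply: eq_bigr => k _; rewrite (morphz _ hD).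
Qed.

Lemma lin_malg (K : choiceType) (x : {malg int[K]}) : lin (@mU K) x = x.
Proof. by rewrite lin.unlock [RHS]monalgE; apply: eq_bigr => k _; rewrite malgUE. Qed.

Lemma lin_uniq (K : choiceType) (W : zmodType) (h : {malg int[K]} -> W) x :
  {morph h : x y / x + y} -> h x = lin (h \o @mU K) x.
Proof. by move=> hD; rewrite -(lin_morph _ _ hD) lin_malg. Qed.

(** Restricting the comparison to the support of x lets conditions on the variables of x be used. *)
Lemma morph_eq_in (K : choiceType) (W : zmodType) (h g : {malg int[K]} -> W) x :
  {morph h : x y / x + y} -> {morph g : x y / x + y} ->
  (forall k, k \in msupp x -> h (mU k) = g (mU k)) -> h x = g x.
Proof. by move=> hD gD e; rewrite (lin_uniq x hD) (lin_uniq x gD); apply: lin_eq_in. Qed.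

Lemma morph_eq (K : choiceType) (W : zmodType) (h g : {malg int[K]} -> W) :
  {morph h : x y / x + y} -> {morph g : x y / x + y} ->
  (forall k, h (mU k) = g (mU k)) -> h =1 g.
Proof. by move=> hD gD e x; apply: morph_eq_in. Qed.

Lemma bilin_eq (K K' : choiceType) (W : zmodType) (F G : {malg int[K]} -> {malg int[K']} -> W) :
  (forall x, {morph F x : y z / y + z}) -> (forall y, {morph F^~ y : x z / x + z}) ->
  (forall x, {morph G x : y z / y + z}) -> (forall y, {morph G^~ y : x z / x + z}) ->
  (forall k l, F (mU k) (mU l) = G (mU k) (mU l)) -> forall x y, F x y = G x y.
Proof.
move=> Fr Fl Gr Gl e x y; apply: (morph_eq (Fl y) (Gl y)) => k.
exact: (morph_eq (Fr (mU k)) (Gr (mU k)) (e k)).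
Qed.

Lemma coef_lin (K K' : choiceType) (f : K -> {malg int[K']}) (x : {malg int[K]}) k :
  (lin f x)@_k = lin (fun j => (f j)@_k) x.
Proof. by rewrite (lin_morph f x (h := mcoeff k)) //; apply: mcoeffD. Qed.

Lemma coefE_lin (K : choiceType) (x : {malg int[K]}) k :
  x@_k = lin (fun j => (j == k)%:R) x.
Proof.
rewrite -{1}[x]lin_malg coef_lin; apply: lin_eq_in => l _; exact: mU_coef.
Qed.

Lemma fs_coef (K : choiceType) (f : K -> int) (x : {malg int[K]}) :
  fs (fun k => x@_k * f k) = lin f x.
Proof.
rewrite (@fsE _ _ (msupp x)); first last.
- by move=> l nk; rewrite mcoeff_outdom ?mul0r.
- exact: fset_uniq.
by rewrite lin.unlock; apply: eq_bigr => k _; rewrite -mulrzr intz mulrC.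
Qed.


(** * Laurent polynomials *)

HB.lock Definition mrenL (I E : finType) (r : var I E -> var I E) (k : mon I E) : mon I E :=
  lin (fun v => mU (r v)) k.
HB.lock Definition lrenL (I E : finType) (r : var I E -> var I E) (x : Lp I E) : Lp I E :=
  lin (fun k => mU (mrenL r k)) x.
HB.lock Definition bdegL (I E : finType) (b : nat) (k : mon I E) : int :=
  lin (fun v => (isblk b v)%:R) k.
HB.lock Definition lmulL (I E : finType) (x y : Lp I E) : Lp I E :=
  lin (fun k => lin (fun l => mU (k + l)) y) x.

Section Laurent.
Variables I E : finType.
Local Notation var := (var I E).
Local Notation mon := (mon I E).
Local Notation Lp := (Lp I E).
Implicit Types (r s : var -> var) (v : var) (k l : mon) (x y z : Lp).

Lemma mrenLE : @mren I E = @mrenL I E.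
Proof.
apply: functional_extensionality => r; apply: functional_extensionality => k.
by rewrite mrenL.unlock lin.unlock; apply: eq_bigr => v _; rewrite malgUE.
Qed.

Lemma lrenLE : @lren I E = @lrenL I E.
Proof.
apply: functional_extensionality => r; apply: functional_extensionality => k.
by rewrite lrenL.unlock lin.unlock /lren mrenLE; apply: eq_bigr => v _; rewrite malgUE.
Qed.

Lemma bdegLE : @bdeg I E = @bdegL I E.
Proof.
apply: functional_extensionality => b; apply: functional_extensionality => k.
rewrite bdegL.unlock lin.unlock /bdeg big_mkcond; apply: eq_bigr => v _.
by case: (isblk b v); rewrite ?intz ?mul0rz.
Qed.

Lemma lmulLE : @lmul I E = @lmulL I E.
Proof.
apply: functional_extensionality => x; apply: functional_extensionality => y.
rewrite lmulL.unlock lin.unlock /lmul.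
have hD c : {morph (fun y : Lp => y *~ c) : a b / a + b} by move=> a b; rewrite mulrzDl.
apply: eq_bigr => k _; rewrite (big_morph _ (hD x@_k) (mul0rz _ _)).
by apply: eq_bigr => l _; rewrite malgUE mulrC mulrzA.
Qed.

Lemma lmonE k : lmon k = mU k :> Lp.
Proof. exact: malgU1E. Qed.

Lemma mvarE v : mvar v = mU v :> mon.
Proof. exact: malgU1E. Qed.

Lemma mrenD r : {morph mrenL r : k l / k + l}.
Proof. by move=> k l; rewrite !mrenL.unlock linD. Qed.

Lemma mrenU r v : mrenL r (mU v) = mU (r v).
Proof. by rewrite mrenL.unlock lin1. Qed.

Lemma lrenD r : {morph lrenL r : x y / x + y}.
Proof. by move=> x y; rewrite !lrenL.unlock linD. Qed.

Lemma lrenU r k : lrenL r (mU k) = mU (mrenL r k).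
Proof. by rewrite lrenL.unlock lin1. Qed.

Lemma mren_eq_in r s k : (forall v, v \in msupp k -> r v = s v) -> mrenL r k = mrenL s k.
Proof. by move=> h; rewrite !mrenL.unlock; apply: lin_eq_in => v /h ->. Qed.

Lemma lren_eq_in r s x :
  (forall k, k \in msupp x -> forall v, v \in msupp k -> r v = s v) -> lrenL r x = lrenL s x.
Proof. by move=> h; rewrite !lrenL.unlock; apply: lin_eq_in => k /h /mren_eq_in ->. Qed.

Lemma mren_comp r s k : mrenL r (mrenL s k) = mrenL (r \o s) k.
Proof.
apply: (morph_eq (h := fun k => mrenL r (mrenL s k)) (g := mrenL (r \o s))) => [a b|a b|v].
- by rewrite !mrenD.
- by rewrite mrenD.
- by rewrite !mrenU.
Qed.

Lemma lren_comp r s x : lrenL r (lrenL s x) = lrenL (r \o s) x.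
Proof.
apply: (morph_eq (h := fun x => lrenL r (lrenL s x)) (g := lrenL (r \o s))) => [a b|a b|k].
- by rewrite !lrenD.
- by rewrite lrenD.
- by rewrite !lrenU mren_comp.
Qed.

Lemma mren_id k : mrenL id k = k.
Proof. by rewrite mrenL.unlock lin_malg. Qed.

Lemma lren_id x : lrenL id x = x.
Proof.
by rewrite lrenL.unlock -[RHS]lin_malg; apply: lin_eq_in => k _; rewrite mren_id.
Qed.

Lemma bdegD b : {morph @bdegL I E b : k l / k + l}.
Proof. by move=> k l; rewrite !bdegL.unlock linD. Qed.

Lemma bdegU b v : bdegL b (mU v) = (isblk b v)%:R :> int.
Proof. by rewrite bdegL.unlock lin1. Qed.

Lemma lhom_coef b d x k : (lhom b d x)@_k = if bdegL b k == d then x@_k else 0.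
Proof.
have -> : lhom b d x = lin (fun k => if bdegL b k == d then mU k else 0) x.
  rewrite /lhom big_mkcond lin.unlock bdegLE; apply: eq_bigr => l _.
  by case: (bdegL b l == d); rewrite ?malgUE ?mul0rz.
rewrite coef_lin (coefE_lin x).
have [hd|nd] := eqVneq (bdegL b k) d.
  apply: lin_eq_in => l _; have [_|nl] := eqVneq (bdegL b l) d; first exact: mU_coef.
  rewrite mcoeff0; have [e|//] := eqVneq l k.
  by move: nl; rewrite e hd eqxx.
rewrite lin.unlock big1 // => l _.
have [hl|_] := eqVneq (bdegL b l) d; last by rewrite mcoeff0 mul0rz.
rewrite mU_coef; have [e|_] := eqVneq l k; last by rewrite mul0rz.
by move: nd; rewrite -e hl eqxx.
Qed.

Lemma lmulDr x : {morph lmulL x : y z / y + z}.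
Proof.
move=> y z; rewrite !lmulL.unlock.
rewrite -lin_addf; apply: lin_eq_in => k _; exact: linD.
Qed.

Lemma lmulDl y : {morph (@lmulL I E)^~ y : x z / x + z}.
Proof. by move=> x z /=; rewrite !lmulL.unlock linD. Qed.

Lemma lmulUU k l : lmulL (mU k) (mU l) = mU (k + l).
Proof. by rewrite lmulL.unlock !lin1. Qed.

Lemma lmul0r y : lmulL 0 y = 0.
Proof. exact: (morph0 (lmulDl y)). Qed.

Lemma lmulr0 x : lmulL x 0 = 0.
Proof. exact: (morph0 (lmulDr x)). Qed.

Lemma lmulC x y : lmulL x y = lmulL y x.
Proof.
apply: (bilin_eq (F := @lmulL I E) (G := fun x y => lmulL y x)) => {x y}.
- exact: lmulDr.
- exact: lmulDl.
- by move=> x y z; rewrite lmulDl.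
- by move=> x y z /=; rewrite lmulDr.
- by move=> k l; rewrite !lmulUU addrC.
Qed.

Lemma lmulA x y z : lmulL x (lmulL y z) = lmulL (lmulL x y) z.
Proof.
apply: (morph_eq (h := fun x => lmulL x (lmulL y z)) (g := fun x => lmulL (lmulL x y) z)).
- by move=> a b; rewrite lmulDl.
- by move=> a b; rewrite !lmulDl.
move=> k; apply: (bilin_eq (F := fun y z => lmulL (mU k) (lmulL y z))
                           (G := fun y z => lmulL (lmulL (mU k) y) z)).
- by move=> a b c; rewrite !lmulDr.
- by move=> a b c /=; rewrite lmulDl lmulDr.
- by move=> a b c; rewrite lmulDr.
- by move=> a b c /=; rewrite lmulDr lmulDl.
- by move=> a b; rewrite !lmulUU addrA.
Qed.

Lemma lmulCA x y z : lmulL x (lmulL y z) = lmulL y (lmulL x z).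
Proof. by rewrite lmulA (lmulC x) -lmulA. Qed.

Lemma lmul1 x : lmulL (mU 0) x = x.
Proof.
apply: (morph_eq (h := lmulL (mU 0)) (g := id)) => //; first exact: lmulDr.
by move=> k; rewrite lmulUU add0r.
Qed.

Lemma lren_lmul r x y : lrenL r (lmulL x y) = lmulL (lrenL r x) (lrenL r y).
Proof.
apply: (bilin_eq (F := fun x y => lrenL r (lmulL x y))
                 (G := fun x y => lmulL (lrenL r x) (lrenL r y))) => {x y}.
- by move=> a b c; rewrite lmulDr lrenD.
- by move=> a b c /=; rewrite lmulDl lrenD.
- by move=> a b c; rewrite lrenD lmulDr.
- by move=> a b c /=; rewrite lrenD lmulDl.
- by move=> a b; rewrite lmulUU !lrenU lmulUU mrenD.
Qed.

Lemma finsup_coef (f : mon -> int) x : finsup (fun k => x@_k * f k).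
Proof. by exists (msupp x) => k nk; rewrite mcoeff_outdom ?mul0r. Qed.

(** In this form the product of coefficients and the product of series combine into one
    convolution. *)
Lemma lmul_coef x y k : (lmulL x y)@_k = fs (fun l => x@_l * y@_(k - l)).
Proof.
rewrite fs_coef lmulL.unlock coef_lin; apply: lin_eq_in => l _.
rewrite coef_lin [RHS]coefE_lin; apply: lin_eq_in => l' _; rewrite mU_coef.
by congr (nat_of_bool _)%:R; rewrite [RHS]eq_sym subr_eq eq_sym addrC.
Qed.

End Laurent.


(** * Series bounded above in both exponents *)

HB.lock Definition smulL (I E : finType) (S T : ser I E) : ser I E := smul S T.

Section Series.
Variables I E : finType.
Local Notation var := (var I E).
Local Notation mon := (mon I E).
Local Notation Lp := (Lp I E).
Local Notation ser := (ser I E).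
Local Notation pt := (int * int * mon)%type.
Implicit Types (r s : var -> var) (v : var) (k l : mon) (x y : Lp) (z : int * int) (S T U X Y : ser) (p q : pt).

Lemma smulLE : @smul I E = @smulL I E.
Proof.
apply: functional_extensionality => S; apply: functional_extensionality => T.
by rewrite smulL.unlock.
Qed.

Lemma fsumE : @fsum I E = @fs int Lp.
Proof. by []. Qed.

(** A series as one integer-valued function on the group Z^2 x mon. Exponents of z, w and of the
    variables play the same role there, and [smul] becomes convolution ([smul_cf]). *)
Definition cf X p : int := (X p.1.1 p.1.2)@_p.2.

Lemma cfP X Y : cf X =1 cf Y -> X = Y.
Proof.
move=> h; apply: functional_extensionality => n; apply: functional_extensionality => m.
by apply/malgP => k; apply: (h (n, m, k)).
Qed.

(** Each coefficient of the product is a finite sum. This is weaker than boundedness of both series: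
    a constant may multiply any series. *)
Definition convolvable S T := forall n m, exists s : seq (int * int), forall i j,
  (i, j) \notin s -> S i j = 0 \/ T (n - i) (m - j) = 0.

Lemma convolvable_finsup S T n m : convolvable S T ->
  finsup (fun ij : int * int => lmulL (S ij.1 ij.2) (T (n - ij.1) (m - ij.2))).
Proof.
move=> /(_ n m)[s cs]; exists s => -[i j] /cs /= [->|->]; [exact: lmul0r | exact: lmulr0].
Qed.

Lemma smul_fs S T n m : convolvable S T ->
  smulL S T n m = fs (fun ij : int * int => lmulL (S ij.1 ij.2) (T (n - ij.1) (m - ij.2))).
Proof.
move=> c; rewrite smulL.unlock /smul lmulLE fsumE -fs_pair //.
exact: convolvable_finsup.
Qed.

Lemma conv_finsup S T p : convolvable S T -> finsup (fun q => cf S q * cf T (p - q)).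
Proof.
case: p => -[n m] k /(_ n m)[s cs].
apply: (@finsup_fiber _ _ _ _ s) => [[i j] l nij|[i j]]; rewrite /cf /=.
  by have [->|->] := cs _ _ nij; rewrite mcoeff0 ?mul0r ?mulr0.
exact: (finsup_coef (fun l => (T (n - i) (m - j))@_(k - l))).
Qed.

Lemma smul_cf S T p : convolvable S T ->
  cf (smulL S T) p = fs (fun q => cf S q * cf T (p - q)).
Proof.
move=> c; rewrite -(fs_pair (conv_finsup p c)); case: p => -[n m] k; rewrite /cf /=.
rewrite smul_fs // (fs_morph (h := mcoeff k) (@mcoeffD _ _ k) (convolvable_finsup n m c)).
by apply: fs_eq => -[i j] /=; rewrite lmul_coef.
Qed.

Definition irange (a b : int) : seq int := [seq a + i%:Z | i <- iota 0 `|b - a|.+1].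

Lemma mem_irange a b i : a <= i -> i <= b -> i \in irange a b.
Proof.
move=> ai ib; apply/mapP; exists `|i - a|%N; last by lia.
by rewrite mem_iota; lia.
Qed.

(** An upper bound N' on the exponent n - i is a lower bound n - N' on i, so the two upper bounds
    leave a finite box. *)
Lemma bdd_convolvable S T : bdd S -> bdd T -> convolvable S T.
Proof.
move=> [N [M hS]] [N' [M' hT]] n m.
exists [seq (i, j) | i <- irange (n - N') N, j <- irange (m - M') M] => i j nij.
have [a|a] := boolP ((N < i) || (M < j)); first by left; apply: hS.
right; apply: hT; apply: contraR nij => b; apply/allpairsP; exists (i, j).
by split=> //=; apply: mem_irange; lia.
Qed.

Lemma convolvable_const x T : convolvable (sconst x) T.
Proof.
move=> n m; exists [:: (0, 0)] => i j; rewrite inE xpair_eqE /sconst => /negbTE ->.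
by left.
Qed.

Lemma bdd_smul S T : bdd S -> bdd T -> bdd (smulL S T).
Proof.
move=> bS bT; have c := bdd_convolvable bS bT.
move: bS bT => [N [M hS]] [N' [M' hT]]; exists (N + N'), (M + M') => n m h.
rewrite smul_fs //; apply: fs0 => -[i j] /=.
have [a|a] := boolP ((N < i) || (M < j)); first by rewrite hS // lmul0r.
by rewrite (hT (n - i)) ?lmulr0 //; lia.
Qed.

Lemma bdd_const x : bdd (sconst x).
Proof.
exists 0, 0 => n m h; rewrite /sconst; case: eqP => [e|//]; case: eqP => [e'|//].
by move: h; rewrite e e'.
Qed.

Lemma smulC S T : bdd S -> bdd T -> smulL S T = smulL T S.
Proof.
move=> bS bT; apply: cfP => p.
have c := bdd_convolvable bS bT; have c' := bdd_convolvable bT bS.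
rewrite !smul_cf // -(fs_reindex (h := fun q => p - q) (k := fun q => p - q) _ _ (conv_finsup p c)).
- by apply: fs_eq => q /=; rewrite subKr mulrC.
- exact: subKr.
- exact: subKr.
Qed.

(** The exponents (i, j) of the first factor lie in a box: i <= N1, and i >= n - N2 - N3 because the
    other two exponents sum to n - i. Over each point of the first factor, [T] and [U] form a single
    convolution. *)
Lemma conv3_finsup S T U p : bdd S -> bdd T -> bdd U ->
  finsup (fun w : pt * pt => cf S w.1 * (cf T w.2 * cf U (p - w.1 - w.2))).
Proof.
move=> bS bT bU; have cTU := bdd_convolvable bT bU.
case: bS bT bU => [N1 [M1 h1]] [N2 [M2 h2]] [N3 [M3 h3]].
case: p => -[n m] k.
pose box := [seq (i, j) | i <- irange (n - N2 - N3) N1, j <- irange (m - M2 - M3) M1].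
pose s := [seq (ij, l) | ij <- box, l <- (msupp (S ij.1 ij.2) : seq mon)].
apply: (@finsup_fiber _ _ _ _ s) => [[[i j] l] [[i' j'] l']|q]; last first.
  by apply: finsup_imp (conv_finsup ((n, m, k) - q) cTU) => a /= ->; rewrite mulr0.
apply: contraNeq; rewrite !mulf_eq0 !negb_or => /and3P[nS nT nU].
rewrite /cf /= in nS nT nU.
have bS : ~~ ((N1 < i) || (M1 < j)) by apply: contraNN nS => /h1 ->; rewrite mcoeff0.
have bT : ~~ ((N2 < i') || (M2 < j')) by apply: contraNN nT => /h2 ->; rewrite mcoeff0.
have bU : ~~ ((N3 < n - i - i') || (M3 < m - j - j')).
  by apply: contraNN nU => /h3 ->; rewrite mcoeff0.
apply/allpairsPdep; exists (i, j), l; split=> //=; last by rewrite -mcoeff_neq0.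
by apply/allpairsP; exists (i, j); split=> //=; apply: mem_irange; lia.
Qed.

Lemma smulA S T U : bdd S -> bdd T -> bdd U ->
  smulL S (smulL T U) = smulL (smulL S T) U.
Proof.
move=> bS bT bU; apply: cfP => p.
have cST := bdd_convolvable bS bT; have cTU := bdd_convolvable bT bU.
have bST := bdd_smul bS bT; have bTU := bdd_smul bT bU.
have c1 := bdd_convolvable bS bTU; have c2 := bdd_convolvable bST bU.
rewrite !smul_cf //.
have E1 q : cf S q * cf (smulL T U) (p - q) =
    fs (fun q' => cf S q * (cf T q' * cf U (p - q - q'))).
  rewrite smul_cf // (fs_morph (h := *%R (cf S q)) _ (conv_finsup _ cTU)) //.
  by move=> a b; rewrite mulrDr.
have E2 q : cf (smulL S T) q * cf U (p - q) =
    fs (fun q' => (cf S q' * cf T (q - q')) * cf U (p - q)).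
  rewrite smul_cf // (fs_morph (h := *%R^~ (cf U (p - q))) _ (conv_finsup _ cST)) //.
  by move=> a b; rewrite mulrDl.
have sub q a : p - q - (a - q) = p - a by rewrite opprB addrA subrK.
rewrite (fs_eq E1) (fs_eq E2) [RHS]fs_exchange.
  apply: fs_eq => q.
  rewrite -[RHS](fs_reindex (h := fun q' => q' + q) (k := fun q' => q' - q)).
  - by apply: fs_eq => q' /=; rewrite addrK mulrA opprD addrA addrAC.
  - by move=> a; rewrite addrK.
  - by move=> a; rewrite subrK.
  - have h := finsup_comp (f := _) (@subrK _ q) (conv_finsup (p - q) cTU).
    by apply: finsup_imp h => a /=; rewrite sub -mulrA => ->; rewrite mulr0.
have h := finsup_comp (f := _) (h := fun w : pt * pt => (w.2, w.1 - w.2))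
  (k := fun w => (w.2 + w.1, w.1)) _ (conv3_finsup p bS bT bU).
apply: finsup_imp (h _) => [[q q']|[q q']] /=; last by rewrite subrK.
by rewrite sub mulrA.
Qed.

Lemma smul_const x T n m : smulL (sconst x) T n m = lmulL x (T n m).
Proof.
rewrite smul_fs; last exact: convolvable_const.
rewrite (@fs_single _ _ (0, 0)) /= ?subr0 // => -[i j].
by rewrite xpair_eqE /sconst => /negbTE ->; rewrite lmul0r.
Qed.

Lemma smul_sscal x T : sscal x T = smulL (sconst x) T.
Proof.
apply: functional_extensionality => n; apply: functional_extensionality => m.
by rewrite smul_const /sscal lmulLE.
Qed.

Lemma smul1 T : smulL (sconst (mU 0)) T = T.
Proof.
apply: functional_extensionality => n; apply: functional_extensionality => m.
by rewrite smul_const lmul1.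
Qed.

Lemma smul1r T : bdd T -> smulL T (sconst (mU 0)) = T.
Proof. by move=> bT; rewrite smulC ?smul1 //; apply: bdd_const. Qed.

Lemma bdd_sadd S T : bdd S -> bdd T -> bdd (sadd S T).
Proof.
move=> [N [M hS]] [N' [M' hT]]; exists (Num.max N N'), (Num.max M M') => n m h.
by rewrite /sadd hS ?hT ?addr0 //; lia.
Qed.

Lemma smulDr S T U : bdd S -> bdd T -> bdd U ->
  smulL S (sadd T U) = sadd (smulL S T) (smulL S U).
Proof.
move=> bS bT bU; have bTU := bdd_sadd bT bU.
have [[c1 c2] c3] := (bdd_convolvable bS bT, bdd_convolvable bS bU, bdd_convolvable bS bTU).
apply: functional_extensionality => n; apply: functional_extensionality => m.
rewrite /sadd !smul_fs // -fsD; try exact: convolvable_finsup.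
by apply: fs_eq => ij; rewrite lmulDr.
Qed.

Lemma renSE r X n m : renS r X n m = lrenL r (X n m).
Proof. by rewrite /renS lrenLE. Qed.

Lemma bdd_ren r X : bdd X -> bdd (renS r X).
Proof.
move=> [N [M h]]; exists N, M => n m /h e; rewrite renSE e; exact: (morph0 (lrenD r)).
Qed.

Lemma renS_smul r S T : bdd S -> bdd T ->
  renS r (smulL S T) = smulL (renS r S) (renS r T).
Proof.
move=> bS bT; have c := bdd_convolvable bS bT.
have c' := bdd_convolvable (bdd_ren r bS) (bdd_ren r bT).
apply: functional_extensionality => n; apply: functional_extensionality => m.
rewrite renSE !smul_fs // (fs_morph (lrenD r) (convolvable_finsup n m c)).
by apply: fs_eq => ij /=; rewrite lren_lmul !renSE.
Qed.

Definition shear (b : nat) (z : int * int) p : pt := (p.1 + z *~ bdegL b p.2, p.2).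

Lemma shearD b z : {morph shear b z : p q / p + q}.
Proof.
by move=> [p k] [q l]; congr pair; rewrite /= bdegD mulrzDr addrACA.
Qed.

Lemma shearK b z : cancel (shear b z) (shear b (- z)).
Proof. by move=> [p k]; rewrite /shear /= mulNrz addrK. Qed.

Lemma shearNK b z : cancel (shear b (- z)) (shear b z).
Proof. by move=> [p k]; rewrite /shear /= mulNrz subrK. Qed.

(* [scaleS] is a sum of possibly infinitely many homogeneous parts; on coefficients it is
   the shear (n, m, k) |-> ((n, m) + deg k z, k), and any series realising this shear is
   the value of [scaleS] (see [scaleS_eq]). *)
Definition scaled b z X X' := forall p, cf X' (shear b z p) = cf X p.

Lemma pair_mulz (z : int * int) d : z *~ d = (d * z.1, d * z.2).
Proof.
rewrite [LHS]surjective_pairing (morphz d (h := fst)) // (morphz d (h := snd)) //.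
by congr pair; rewrite -mulrzl intz.
Qed.

(** Finiteness of the sum over degrees comes from [X']: its coefficient at (n, m) is one Laurent
    polynomial, so only the degrees of its monomials contribute. *)
Lemma scaleS_eq b z X X' : scaled b z X X' -> scaleS b z X = X'.
Proof.
move=> h; apply: functional_extensionality => n; apply: functional_extensionality => m.
have e k : (X' n m)@_k = (X (n - bdegL b k * z.1) (m - bdegL b k * z.2))@_k.
  have := h (shear b (- z) (n, m, k)); rewrite shearNK /cf /= => ->.
  by rewrite mulNrz pair_mulz.
have hD k : {morph (fun y : Lp => y@_k) : a c / a + c} by exact: mcoeffD.
apply/malgP => k; rewrite /scaleS fsumE (fs_morph (hD k)) => [|{k}].
  rewrite (@fs_single _ _ (bdegL b k)) /= => [|d nd]; first by rewrite lhom_coef eqxx e.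
  by rewrite /= lhom_coef eq_sym (negbTE nd).
exists [seq bdegL b k | k <- (msupp (X' n m) : seq mon)] => d nd.
apply/malgP => k; rewrite lhom_coef mcoeff0; have [dk|//] := eqVneq.
rewrite -dk -e; apply: mcoeff_outdom; apply: contra nd => kx.
by apply/mapP; exists k.
Qed.

(** The shear is an automorphism of [pt] and so transports convolutions. The scaled series are
    assumed bounded separately, because scaling may destroy boundedness. *)
Lemma scaled_smul b z X X' Y Y' : bdd X -> bdd X' -> bdd Y -> bdd Y' ->
  scaled b z X X' -> scaled b z Y Y' -> scaled b z (smulL X Y) (smulL X' Y').
Proof.
move=> bX bX' bY bY' hX hY p.
have c := bdd_convolvable bX bY; have c' := bdd_convolvable bX' bY'.
rewrite !smul_cf //.
rewrite -(fs_reindex (@shearK b z) (@shearNK b z) (conv_finsup (shear b z p) c')).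
by apply: fs_eq => q /=; rewrite -(morphB (@shearD b z)) hX hY.
Qed.

End Series.


(** * The factors (1 - zeta r)^{+1} and (1 - zeta r)^{-1} *)

(** The factor depends on the single group element p = zeta r, so that renaming and scaling act on p
    alone. *)
HB.lock Definition facL (I E : finType) (p : int * int * mon I E) (pos : bool) : ser I E :=
  fac p.1 p.2 pos.

Section Factors.
Variables I E : finType.
Local Notation var := (var I E).
Local Notation mon := (mon I E).
Local Notation Lp := (Lp I E).
Local Notation ser := (ser I E).
Local Notation pt := (int * int * mon)%type.
Implicit Types (r s : var -> var) (v : var) (k : mon) (x y : Lp) (z : int * int).
Implicit Types (X Y : ser) (p q : pt).

(** The monomials z, w, zw and their inverses. [fac] recovers the power of zeta from an exponent by
    multiplying with a coordinate of zeta, which requires this coordinate to be 1 or -1. *)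
Definition goodz z : bool :=
  z \in [:: (1, 0); (-1, 0); (0, 1); (0, -1); (1, 1); (-1, -1)].
Definition large z : bool := 0 < z.1 + z.2.

Lemma goodzP z : goodz z ->
  [\/ z = (1, 0), z = (-1, 0), z = (0, 1) | [\/ z = (0, -1), z = (1, 1) | z = (-1, -1)]].
Proof.
rewrite /goodz !inE => /orP[/eqP->|/orP[/eqP->|/orP[/eqP->|/orP[/eqP->|/orP[/eqP->|/eqP->]]]]].
- by constructor 1.
- by constructor 2.
- by constructor 3.
- by constructor 4; constructor 1.
- by constructor 4; constructor 2.
- by constructor 4; constructor 3.
Qed.

(** The coefficient of p^k in 1 - p, or in its inverse expanded in negative powers ([lg]) or in
    non-negative powers of p. *)
Definition fcoef (pos lg : bool) (k : int) : int :=
  if pos then (k == 0)%:R - (k == 1)%:R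
  else if lg then - (k < 0)%R%:R else (0 <= k)%R%:R.

Lemma pt_mulz p (d : int) : p *~ d = (d * p.1.1, d * p.1.2, p.2 *~ d).
Proof.
case: p => z k /=; rewrite -pair_mulz [LHS]surjective_pairing.
by rewrite (morphz d (h := fst)) // (morphz d (h := snd)).
Qed.

Lemma pt_mulz_eq0 p (d : int) : goodz p.1 -> (p *~ d == 0) = (d == 0).
Proof.
move=> g; apply/eqP/eqP => [|->]; last by rewrite mulr0z.
rewrite pt_mulz => -[]; case: p g => -[a b] k /= /goodzP.
by case=> [[-> ->]|[-> ->]|[-> ->]|[[-> ->]|[-> ->]|[-> ->]]] /= *; lia.
Qed.

Lemma facLE z k pos : fac z k pos = facL (z, k) pos :> ser.
Proof. by rewrite facL.unlock. Qed.

Lemma mulr_root z (c : int) : goodz z ->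
  (if z.1 != 0 then c * z.1 * z.1 else c * z.2 * z.2) = c.
Proof. by move=> /goodzP[->|->|->|[->|->|->]] /=; lia. Qed.

Lemma fac_coefs p pos n m (d := if p.1.1 != 0 then n * p.1.1 else m * p.1.2) : goodz p.1 ->
  facL p pos n m =
    if (n == d * p.1.1) && (m == d * p.1.2) then mU (p.2 *~ d) *~ fcoef pos (large p.1) d
    else 0.
Proof.
rewrite facL.unlock /fac -/d -negb_and => _.
case: (_ && _) => //=; rewrite /lone !lmonE /fcoef /large.
case: pos.
  have [->|d0] := eqVneq d 0; first by rewrite mulr0z subr0.
  have [->|d1] := eqVneq d 1; first by rewrite mulr1z sub0r mulrNz mulr1z.
  by rewrite subr0 mulr0z.
case: (0 < p.1.1 + p.1.2); first by case: (d < 0); rewrite ?oppr0 ?mulr0z ?mulrNz ?mulr1z.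
by case: (0 <= d); rewrite ?mulr0z ?mulr1z.
Qed.

Lemma mulz_coef (K : choiceType) (x : {malg int[K]}) c (j : K) : (x *~ c)@_j = x@_j * c.
Proof. by rewrite (morphz c (@mcoeffD _ _ j)) -mulrzr intz. Qed.

Lemma cf_fac_on p pos (c : int) : goodz p.1 ->
  cf (facL p pos) (p *~ c) = fcoef pos (large p.1) c.
Proof.
move=> g; rewrite pt_mulz /cf /= fac_coefs //.
rewrite mulr_root // !eqxx /= mulz_coef mU_coef eqxx mul1r //.
Qed.

Lemma cf_fac_off p pos q : goodz p.1 -> (forall c, q <> p *~ c) -> cf (facL p pos) q = 0.
Proof.
move=> g no; case: q no => -[n m] k no; rewrite /cf /= fac_coefs //.
set d := (if p.1.1 != 0 then _ else _).
case: andP => [[/eqP en /eqP em]|_]; last by rewrite mcoeff0.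
rewrite mulz_coef mU_coef; case: eqP => [ek|_]; last by rewrite mul0r.
by case: (no d); rewrite pt_mulz -ek -en -em.
Qed.

(** The bound 1 accommodates the linear term of 1 - zeta r for a large zeta. The inverses have no
    positive exponent: a large zeta occurs in negative powers, a small one in non-negative
    powers. *)
Lemma bdd_fac p pos : goodz p.1 -> bdd (facL p pos).
Proof.
move=> g; exists 1, 1 => n m h; rewrite fac_coefs //; case: andP => // -[/eqP en /eqP em].
rewrite [fcoef _ _ _](_ : _ = 0) ?mulr0z // /fcoef /large.
by move/goodzP: g h en em => [->|->|->|[->|->|->]] /= h en em; case: pos; lia.
Qed.

(** Off the multiples of p every term vanishes. At p *~ c only the terms at 0 and p of the first
    factor survive and give b_c - b_{c-1}, with b the coefficients of the inverse; for both
    expansions this is 1 at c = 0 and 0 elsewhere. *)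
Lemma fac_inv p : goodz p.1 -> smulL (facL p true) (facL p false) = sconst (mU 0).
Proof.
move=> g; apply: cfP => q.
have p0 : p != 0 by rewrite -(mulr1z p) pt_mulz_eq0.
rewrite smul_cf; last by apply: bdd_convolvable; apply: bdd_fac.
have [[c ->{q}]|no] := excluded_middle_informative (exists c, q = p *~ c); last first.
  have noc c : q <> p *~ c by move=> e; apply: no; exists c.
  rewrite fs0 => [|q'].
    move: (noc 0); rewrite mulr0z /cf /sconst; case: q {no noc} => -[n m] k /= n0.
    case: eqP => [n0'|_]; case: eqP => [m0|_] /=; rewrite ?mcoeff0 // mU_coef.
    by case: eqP => // k0; case: n0; rewrite n0' m0 -k0.
  have [[c e]|no'] := excluded_middle_informative (exists c, q' = p *~ c).
    rewrite (@cf_fac_off _ _ (q - q')) ?mulr0 // => c' e'; apply: (noc (c' + c)).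
    by rewrite mulrzDr -e -e' subrK.
  by rewrite (@cf_fac_off _ _ q') ?mul0r // => c e; apply: no'; exists c.
rewrite (@fsE _ _ [:: 0; p]); first last.
- move=> q'; rewrite !inE negb_or => /andP[q0 qp].
  have [[c' e]|no'] := excluded_middle_informative (exists c, q' = p *~ c); last first.
    by rewrite (@cf_fac_off _ _ q') ?mul0r // => c' e; apply: no'; exists c'.
  rewrite e cf_fac_on // /fcoef.
  have /negbTE -> : c' != 0 by apply: contraNneq q0 => c0; rewrite e c0 mulr0z.
  have /negbTE -> : c' != 1 by apply: contraNneq qp => c1; rewrite e c1 mulr1z.
  by rewrite subr0 mul0r.
- by rewrite /= inE eq_sym p0.
have e0 := cf_fac_on true 0 g; rewrite mulr0z in e0.
have e1 := cf_fac_on true 1 g; rewrite mulr1z in e1.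
have e2 : p *~ c - p = p *~ (c - 1) by rewrite mulrzBr mulr1z.
rewrite big_cons big_seq1 subr0 e0 e1 e2 !cf_fac_on //.
rewrite /cf /sconst.
have -> : ((p *~ c).1.1 == 0) && ((p *~ c).1.2 == 0) = (c == 0).
  rewrite pt_mulz /=; move/goodzP: g => [->|->|->|[->|->|->]] /=; lia.
have [->|c0] := eqVneq c 0.
  by rewrite mulr0z mU_coef eqxx /fcoef /=; case: large.
rewrite mcoeff0 /fcoef /=; case: large; lia.
Qed.

End Factors.


(** * Normal forms *)

Section NormalForms.
Variables I E : finType.
Local Notation var := (var I E).
Local Notation mon := (mon I E).
Local Notation Lp := (Lp I E).
Local Notation ser := (ser I E).
Local Notation pt := (int * int * mon)%type.
Implicit Types (r s : var -> var) (v : var) (k : mon) (x y : Lp) (z : int * int).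
Implicit Types (X Y : ser) (p q : pt) (l : seq (pt * bool)) (f g h : mon -> pt).

Definition renP r p : pt := (p.1, mrenL r p.2).

Lemma renPD r : {morph renP r : p q / p + q}.
Proof. by move=> [p k] [q k']; congr pair; rewrite /= mrenD. Qed.

Lemma ren_fac r p pos : goodz p.1 -> renS r (facL p pos) = facL (renP r p) pos.
Proof.
move=> g; apply: functional_extensionality => n; apply: functional_extensionality => m.
rewrite renSE !fac_coefs //=; case: (_ && _); last exact: (morph0 (lrenD r)).
by rewrite (morphz _ (lrenD r)) lrenU (morphz _ (mrenD r)).
Qed.

Lemma scaled_fac b z p pos : goodz p.1 -> goodz (shear b z p).1 ->
  large p.1 = large (shear b z p).1 -> scaled b z (facL p pos) (facL (shear b z p) pos).
Proof.
move=> g g' e q.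
have [[c ->{q}]|no] := excluded_middle_informative (exists c, q = p *~ c).
  by rewrite (morphz _ (@shearD _ _ b z)) !cf_fac_on // e.
rewrite !cf_fac_off // => [c ec|c]; first by apply: no; exists c.
rewrite -(morphz _ (@shearD _ _ b z)) => /(can_inj (@shearK _ _ b z)) ec.
by apply: no; exists c.
Qed.

Definition glam l : ser := foldr (fun c => smulL (facL c.1 c.2)) (sconst (mU 0)) l.
Definition goodl l : bool := all (fun c => goodz c.1.1) l.
Definition hmap (h : pt -> pt) l := [seq (h c.1, c.2) | c <- l].
Definition flip l := [seq (c.1, ~~ c.2) | c <- l].

Lemma goodl_cat l l' : goodl (l ++ l') = goodl l && goodl l'.
Proof. exact: all_cat. Qed.

Lemma goodl_flip l : goodl (flip l) = goodl l.
Proof. exact: all_map. Qed.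

Lemma goodl_ren r l : goodl (hmap (renP r) l) = goodl l.
Proof. exact: all_map. Qed.

Lemma bdd_glam l : goodl l -> bdd (glam l).
Proof.
elim: l => [_|c l IH /= /andP[gc gl]]; first exact: bdd_const.
by apply: bdd_smul; [apply: bdd_fac | apply: IH].
Qed.

Lemma glam_cat l l' : goodl l -> goodl l' -> glam (l ++ l') = smulL (glam l) (glam l').
Proof.
move=> gl gl'; elim: l gl => [_|c l IH /= /andP[gc gl]] /=; first by rewrite smul1.
by rewrite IH // smulA //; [apply: bdd_fac | apply: bdd_glam | apply: bdd_glam].
Qed.

Lemma glam_perm l l' : perm_eq l l' -> goodl l -> glam l = glam l'.
Proof.
move=> pl gl.
suff: goodl l' /\ glam l = glam l' by case.
(* Goodness of the list is carried along because commutativity of the product is available for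
   bounded series. *)
apply: (catCA_perm_ind (P := fun l' => goodl l' /\ glam l = glam l')) pl _; last by [].
move=> l1 l2 l3 []; rewrite !goodl_cat => /and3P[g1 g2 g3] ->; split; first exact/and3P.
have gC : glam (l1 ++ l2) = glam (l2 ++ l1).
  by rewrite !glam_cat // smulC //; apply: bdd_glam.
by rewrite !catA glam_cat ?gC -?glam_cat ?goodl_cat ?g1 ?g2.
Qed.

(** Flipping a sign keeps zeta, so each factor meets its inverse in the expansion prescribed by the
    same zeta. *)
Lemma glam_flip l : goodl l -> glam (l ++ flip l) = sconst (mU 0).
Proof.
elim: l => [//|c l IH] /[dup] g /= /andP[gc gl].
have gf : goodl (flip l) by rewrite goodl_flip.
have -> : facL c.1 c.2 = glam [:: c] by rewrite /= smul1r //; apply: bdd_fac.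
have gc1 : goodl [:: c] by rewrite /= gc.
have gc2 : goodl [:: (c.1, ~~ c.2)] by rewrite /= gc.
rewrite -glam_cat ?goodl_cat ?gl ?gc1 //; last by rewrite /= gc.
rewrite (@glam_perm _ (([:: c] ++ [:: (c.1, ~~ c.2)]) ++ (l ++ flip l))).
- rewrite glam_cat ?goodl_cat ?gl ?gc1 ?gc2 // IH // smul1r; last first.
    by apply: bdd_glam; rewrite goodl_cat gc1.
  rewrite /= smul1r; last exact: bdd_fac.
  case: c.2 => /=; first exact: fac_inv.
  by rewrite smulC; [exact: fac_inv | apply: bdd_fac | apply: bdd_fac].
- by rewrite /= perm_cons perm_catC /= perm_cons perm_catC.
- by rewrite /= gc goodl_cat gl /= gc.
Qed.

Lemma ren_glam r l : goodl l -> renS r (glam l) = glam (hmap (renP r) l).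
Proof.
elim: l => [_|c l IH /= /andP[gc gl]] /=.
  apply: functional_extensionality => n; apply: functional_extensionality => m.
  rewrite renSE /sconst; case: (_ && _); last exact: (morph0 (lrenD r)).
  by rewrite lrenU (morph0 (mrenD r)).
by rewrite renS_smul ?IH ?ren_fac //; [apply: bdd_fac | apply: bdd_glam].
Qed.

(* A factor may be rescaled only if the new formal variable is still expanded at the same
   end; otherwise the scaled series is not the expansion of the scaled factor. *)
Definition scalable b z l : bool :=
  all (fun c => goodz (shear b z c.1).1 && (large c.1.1 == large (shear b z c.1).1)) l.

Lemma goodl_shear b z l : scalable b z l -> goodl (hmap (shear b z) l).
Proof. by rewrite /goodl all_map; apply: sub_all => c /andP[]. Qed.

Lemma scalable_cat b z l l' : scalable b z (l ++ l') = scalable b z l && scalable b z l'.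
Proof. exact: all_cat. Qed.

Lemma scaled_glam b z l : goodl l -> scalable b z l ->
  scaled b z (glam l) (glam (hmap (shear b z) l)).
Proof.
elim: l => [_ _ q|c l IH /= /andP[gc gl] /andP[/andP[sc /eqP lc] sl]] /=.
  rewrite -{1}[q](@shearK _ _ b z) shearK; case: q => -[n m] k.
  rewrite /cf /sconst /shear /= pair_mulz.
  have [->|k0] := eqVneq k 0.
    by rewrite (morph0 (@bdegD _ _ b)) !mul0r !addr0.
  by case: (_ && _); case: (_ && _); rewrite ?mcoeff0 ?mU_coef ?(eq_sym 0) ?(negbTE k0).
by apply: scaled_smul; [apply: bdd_fac| apply: bdd_fac | apply: bdd_glam
  | apply/bdd_glam/goodl_shear | apply: scaled_fac | apply: IH].
Qed.

(* The substitution v |-> f v in a Laurent polynomial, where f v is a monomial in z, w and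
   the variables. *)
Definition push f x : ser := fun n m =>
  lin (fun k => if (f k).1 == (n, m) then mU (f k).2 else 0) x.

Lemma push_cf f x q : cf (push f x) q = lin (fun k => (f k == q)%:R) x.
Proof.
rewrite /cf /push coef_lin; apply: lin_eq_in => k _; case: q => -[n m] k' /=.
case: (f k) => a b; rewrite /= [in RHS]xpair_eqE; case: (a == _); last exact: mcoeff0.
by rewrite mU_coef.
Qed.

Lemma push_eq_in f g x : (forall k, k \in msupp x -> f k = g k) -> push f x = push g x.
Proof. by move=> e; apply: cfP => q; rewrite !push_cf; apply: lin_eq_in => k /e ->. Qed.

Lemma seq_bound (T : eqType) (F : T -> int) (t : seq T) :
  exists N : int, forall a, a \in t -> F a <= N.
Proof.
elim: t => [|a t [N hN]]; first by exists 0.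
exists (Num.max N (F a)) => a'; rewrite inE => /orP[/eqP->|/hN]; lia.
Qed.

Lemma push0 f x n m : (forall k, k \in msupp x -> (f k).1 != (n, m)) -> push f x n m = 0.
Proof.
move=> h; rewrite /push lin.unlock big_seq big1 // => k /h /negbTE ->; exact: mul0rz.
Qed.

Lemma bdd_push f x : bdd (push f x).
Proof.
have [N hN] := seq_bound (fun k => (f k).1.1) (msupp x).
have [M hM] := seq_bound (fun k => (f k).1.2) (msupp x).
exists N, M => n m b; apply: push0 => k kx; apply/eqP => e.
by have := hN k kx; have := hM k kx; rewrite e /=; lia.
Qed.

Lemma ren_push r f x : renS r (push f x) = push (renP r \o f) x.
Proof.
apply: functional_extensionality => n; apply: functional_extensionality => m.
rewrite renSE /push (lin_morph _ _ (lrenD r)); apply: lin_eq_in => k _ /=.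
by case: ((f k).1 == (n, m)); rewrite ?lrenU // (morph0 (lrenD r)).
Qed.

Lemma scaled_push b z f x : scaled b z (push f x) (push (shear b z \o f) x).
Proof.
move=> q; rewrite !push_cf; apply: lin_eq_in => k _ /=.
by rewrite (can_eq (@shearK _ _ b z)).
Qed.

Definition pinc k : pt := (0, k).

Lemma sconst_push x : sconst x = push pinc x.
Proof.
apply: functional_extensionality => n; apply: functional_extensionality => m.
rewrite /sconst /push /pinc /= [_ == (n, m)]xpair_eqE ![0 == _]eq_sym.
case: (_ && _); first by rewrite lin_malg.
by rewrite lin.unlock big1 // => k _; exact: mul0rz.
Qed.

Lemma pushD f x y : push f (x + y) = sadd (push f x) (push f y).
Proof.
apply: functional_extensionality => n; apply: functional_extensionality => m.
exact: linD.
Qed.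

Lemma push_lren f r x : push f (lrenL r x) = push (f \o mrenL r) x.
Proof.
apply: functional_extensionality => n; apply: functional_extensionality => m.
rewrite /push lrenL.unlock (lin_morph _ _ (linD _)).
by apply: lin_eq_in => k _ /=; rewrite lin1.
Qed.

(** The source of linearity over [kT]: the substitutions in use do not affect torus variables, so
    torus polynomials come out as scalars. Additivity in x and y reduces the claim to monomials. *)
Lemma push_lmul f x y : {morph f : k k' / k + k'} ->
  (forall k, k \in msupp x -> f k = pinc k) ->
  push f (lmulL x y) = sscal x (push f y).
Proof.
move=> fD fx; rewrite smul_sscal.
apply: functional_extensionality => n; apply: functional_extensionality => m.
rewrite smul_const /push.
pose F u := lin (fun k => if (f k).1 == (n, m) then mU (f k).2 : Lp else 0) (lmulL u y).
pose G u := lmulL u (lin (fun k => if (f k).1 == (n, m) then mU (f k).2 else 0) y).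
rewrite -/(F x) -/(G x); apply: morph_eq_in => [a b|a b|k kx].
- by rewrite /F lmulDl linD.
- by rewrite /G lmulDl.
rewrite /F /G {F G}; move: y.
apply: (@morph_eq _ _ (fun y => lin _ (lmulL (mU k) y))) => [a b|a b|k'].
- by rewrite lmulDr linD.
- by rewrite linD lmulDr.
rewrite lmulUU !lin1 fD fx //= add0r.
by case: (_ == _); rewrite ?lmulUU ?lmulr0.
Qed.

Definition nf l f x : ser := smulL (glam l) (push f x).

Lemma bdd_nf l f x : goodl l -> bdd (nf l f x).
Proof. by move=> g; apply: bdd_smul; [apply: bdd_glam | apply: bdd_push]. Qed.

Lemma nf_nil f x : nf [::] f x = push f x.
Proof. exact: smul1. Qed.

Lemma mul_nf l l' f x : goodl l -> goodl l' -> smulL (glam l) (nf l' f x) = nf (l ++ l') f x.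
Proof.
move=> g g'; rewrite /nf glam_cat // smulA //.
all: try exact: bdd_glam.
exact: bdd_push.
Qed.

Lemma ren_nf r l f x : goodl l -> renS r (nf l f x) = nf (hmap (renP r) l) (renP r \o f) x.
Proof.
by move=> g; rewrite renS_smul ?ren_glam ?ren_push //; [apply: bdd_glam | apply: bdd_push].
Qed.

Lemma scale_nf b z l f x : goodl l -> scalable b z l ->
  scaleS b z (nf l f x) = nf (hmap (shear b z) l) (shear b z \o f) x.
Proof.
move=> g s; apply: scaleS_eq; apply: scaled_smul; try exact: bdd_push.
- exact: bdd_glam.
- exact/bdd_glam/goodl_shear.
- exact: scaled_glam.
- exact: scaled_push.
Qed.

Lemma nf_eq l l' f g x : goodl l -> perm_eq l l' ->
  (forall k, k \in msupp x -> f k = g k) -> nf l f x = nf l' g x.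
Proof. by move=> gl pl e; rewrite /nf (glam_perm pl gl) (push_eq_in e). Qed.

Lemma nf_cancel l l' f x : goodl l -> goodl l' -> nf (l ++ flip l ++ l') f x = nf l' f x.
Proof.
move=> g g'; rewrite /nf catA glam_cat ?glam_flip ?smul1 //.
by rewrite goodl_cat goodl_flip g.
Qed.

Lemma lam_glam z (rs : seq (mon * bool)) : lam z rs = glam [seq ((z, c.1), c.2) | c <- rs].
Proof.
rewrite /lam /sprod smulLE; elim: rs => [|c rs IH] /=; first by rewrite /lone lmonE.
by rewrite IH facLE.
Qed.

End NormalForms.


(** * Chern roots of the bilinear element *)

HB.lock Definition YopL (I E : finType) (src tgt : E -> I) (kd : kind) (p : nat)
  (a b : I -> nat) (z : int * int) (X : ser I E) : ser I E := Yop src tgt kd p a b z X.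
HB.lock Definition SopL (I E : finType) (src tgt : E -> I) (kd : kind) (p : nat)
  (a b : I -> nat) (z : int * int) (X : ser I E) : ser I E := Sop src tgt kd p a b z X.

Section RootLists.
Variables (I E : finType) (src tgt : E -> I) (kd : kind).
Local Notation var := (var I E).
Local Notation mon := (mon I E).
Local Notation Lp := (Lp I E).
Local Notation ser := (ser I E).
Local Notation pt := (int * int * mon)%type.
Implicit Types (r s : var -> var) (v : var) (k : mon) (x y : Lp) (z : int * int).
Implicit Types (p q : pt) (l : seq (pt * bool)) (a b c : I -> nat).
Implicit Types (A B : I -> seq pt) (d e : nat).

(* The terms - V_i^dual V_i of the bilinear element are treated as loops of weight 1 and
   negative sign. *)
Definition legs : seq (I * I * mon * bool) :=
  [seq (t, true) | t <- wedges src tgt kd] ++ [seq (i, i, 0, false) | i <- enum I].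

(** With [A i] and [B i] the Chern roots of two bundles at vertex i, an entry is zeta w^{-1} p / q,
    from the dual of w V_A^vee V_B. Arbitrary lists in place of variables let direct sums and
    substitutions act on the arguments. *)
Definition ER z A B : seq (pt * bool) :=
  flatten [seq [seq ((z, - t.1.2) + p - q, t.2) | p <- A t.1.1.1, q <- B t.1.1.2] | t <- legs].

Definition blk d a : I -> seq pt := fun i => [seq (0, mU (sv E d i j)) | j <- iota 0 (a i)].

Definition BR z d a e b := ER z (blk d a) (blk e b).

Lemma Eroots_BR z d a e b :
  [seq ((z, u.1), u.2) | u <- Eroots src tgt kd a b d e] = BR z d a e b.
Proof.
have aux (i i' : I) (w : mon) (t : bool) (g : nat -> nat -> mon) :
    (forall m n, g m n = mvar (sv E d i m) - mvar (sv E e i' n) - w) ->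
    [seq ((z, u.1), u.2) | u <- flatten [seq [seq (g m n, t) | n <- iota 0 (b i')] | m <- iota 0 (a i)]]
    = [seq ((z, - w) + p - q, t) | p <- blk d a i, q <- blk e b i'].
  move=> gE; rewrite map_flatten -map_comp allpairs_mapl.
  congr flatten; apply: eq_map => m /=; rewrite -!map_comp; apply: eq_map => n /=.
  congr pair; rewrite gE !mvarE; congr pair; first by rewrite /= subr0 addr0.
  by rewrite /= addrC addrA addrAC [- w + _]addrC addrC addrA.
rewrite /Eroots /BR /ER /legs; move: (wedges src tgt kd) (enum I) => W V.
rewrite map_cat !map_flatten -!map_comp map_cat flatten_cat -!map_comp.
congr (_ ++ _); congr flatten; apply: eq_map => t /=.
  exact: (aux _ _ t.2).
by apply: (aux _ _ 0) => m n; rewrite subr0.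
Qed.

Lemma perm_flatten_cat (S T : eqType) (F G : S -> seq T) (u : seq S) :
  perm_eq (flatten [seq F t ++ G t | t <- u]) (flatten (map F u) ++ flatten (map G u)).
Proof.
elim: u => //= t u IH; rewrite -!catA perm_cat2l perm_sym perm_catCA perm_cat2l perm_sym.
exact: IH.
Qed.

Lemma perm_flatten_map (S T : eqType) (F G : S -> seq T) (u : seq S) :
  (forall t, perm_eq (F t) (G t)) -> perm_eq (flatten (map F u)) (flatten (map G u)).
Proof. by move=> FG; elim: u => //= t u IH; apply: perm_cat. Qed.

(** Bilinearity in the first argument; only a permutation, because the legs interleave the two
    contributions. *)
Lemma ER_catl z A A' B :
  perm_eq (ER z (fun i => A i ++ A' i) B) (ER z A B ++ ER z A' B).
Proof.
apply: perm_trans (perm_flatten_cat _ _ _).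
by apply: perm_flatten_map => t; rewrite allpairs_cat.
Qed.

Lemma ER_catr z A B B' :
  perm_eq (ER z A (fun i => B i ++ B' i)) (ER z A B ++ ER z A B').
Proof.
apply: perm_trans (perm_flatten_cat _ _ _).
by apply: perm_flatten_map => t; apply/permPl; apply: perm_allpairs_catr.
Qed.

Lemma ER_perm z A A' B B' : (forall i, perm_eq (A i) (A' i)) ->
  (forall i, perm_eq (B i) (B' i)) -> perm_eq (ER z A B) (ER z A' B').
Proof. by move=> hA hB; apply: perm_flatten_map => t; apply: perm_allpairs. Qed.

Lemma ER_eq z A A' B B' : A =1 A' -> B =1 B' -> ER z A B = ER z A' B'.
Proof. by move=> hA hB; congr flatten; apply: eq_map => t; rewrite hA hB. Qed.

Lemma hmap_cat (h : pt -> pt) l l' : hmap h (l ++ l') = hmap h l ++ hmap h l'.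
Proof. exact: map_cat. Qed.

Lemma hmap_flip (h : pt -> pt) l : hmap h (flip l) = flip (hmap h l).
Proof. by rewrite /hmap /flip -!map_comp. Qed.

Lemma flip_cat l l' : flip (l ++ l') = flip l ++ flip l'.
Proof. exact: map_cat. Qed.

Lemma hmap_ER (h : pt -> pt) z A B : {morph h : p q / p + q} ->
  (forall t, t \in legs -> h (z, - t.1.2) = (z, - t.1.2)) ->
  hmap h (ER z A B) = ER z (fun i => map h (A i)) (fun i => map h (B i)).
Proof.
move=> hD hw; rewrite /hmap /ER map_flatten -map_comp; congr flatten.
apply/eq_in_map => t /hw ht /=; rewrite map_allpairs allpairs_mapl allpairs_mapr.
apply: eq_allpairs => p q /=; by rewrite (morphB hD) hD ht.
Qed.

Lemma hmap_ER_shift z A B (z1 z2 : int * int) :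
  ER z (fun i => [seq (z1, 0) + p | p <- A i]) (fun i => [seq (z2, 0) + p | p <- B i])
  = ER (z + z1 - z2) A B.
Proof.
congr flatten; apply: eq_map => t; rewrite allpairs_mapl allpairs_mapr.
apply: eq_allpairs => p q; congr pair.
rewrite [(z + z1 - z2, _)](_ : _ = (z, - t.1.2) + (z1, 0) - (z2, 0)).
  rewrite addrA opprD addrA; congr (_ - _); exact: addrAC.
by congr pair; rewrite /= !(oppr0, addr0).
Qed.

(** The weights involve torus variables only. With [g] the identity this shows that renamings fix
    the weights, with [g] zero that the weights have degree 0. *)
Lemma legs_torus (W : zmodType) (h g : mon -> W) t :
  {morph h : k k' / k + k'} -> {morph g : k k' / k + k'} ->
  (forall u : (E + unit)%type, h (mU (inl u)) = g (mU (inl u))) -> t \in legs ->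
  h t.1.2 = g t.1.2.
Proof.
move=> hD gD hu; rewrite /legs /wedges mem_cat => /orP[/mapP[w wt ->]|/mapP[i _ ->]]; last first.
  by rewrite (morph0 hD) (morph0 gD).
have hh : h (mvar (hv I E)) = g (mvar (hv I E)) by rewrite mvarE hu.
have ha (e0 : E) : h (mvar (av I e0)) = g (mvar (av I e0)) by rewrite mvarE hu.
move: wt; rewrite !mem_cat => /or3P[/mapP[e0 _ ->]|wt|wt] /=; first exact: ha.
  by case: kd wt => // /mapP[e0 _ ->] /=; rewrite (morphB hD) (morphB gD) hh ha.
by case: kd wt => // /mapP[e0 _ ->] /=; rewrite (morphN hD) (morphN gD) hh.
Qed.

Definition torusfix r := forall u, r (inl u) = inl u.

Lemma ren_BR r z d a e b : torusfix r -> hmap (renP r) (BR z d a e b)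
  = ER z (fun i => map (renP r) (blk d a i)) (fun i => map (renP r) (blk e b i)).
Proof.
move=> hr; apply: hmap_ER => [|t tl]; first exact: renPD.
rewrite /renP /= (morphN (mrenD r)) (legs_torus (g := id) (mrenD r) _ _ tl) // => u.
by rewrite mrenU hr.
Qed.

(** A root contains a variable of block d to the power 1 and one of block e to the power -1, so
    scaling block n multiplies zeta by z' if d = n and divides it by z' if e = n. *)
Lemma shear_BR n (z' z : int * int) d a e b : hmap (shear n z') (BR z d a e b) =
  BR (z + z' *~ (d == n)%:R - z' *~ (e == n)%:R) d a e b.
Proof.
rewrite hmap_ER; first last.
- move=> t tl; rewrite /shear /= (morphN (@bdegD _ _ n)).
  rewrite (legs_torus (g := fun=> 0) (@bdegD _ _ n) _ _ tl) => [|k k'|u].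
  + by rewrite oppr0 mulr0z addr0.
  + by rewrite addr0.
  + by rewrite bdegU.
- exact: shearD.
rewrite /BR -hmap_ER_shift; apply: ER_eq => i; rewrite -!map_comp; apply: eq_map => j /=.
  by rewrite /shear /= bdegU; congr pair; rewrite /= ?add0r ?addr0.
by rewrite /shear /= bdegU; congr pair; rewrite /= ?add0r ?addr0.
Qed.

Lemma BR_zeta z d a e b u : u \in BR z d a e b -> u.1.1 = z.
Proof.
move=> /flattenP[l /mapP[t _ ->]] /allpairsP[[p q] /= [pA qB ->]] /=.
case/mapP: pA => j _ ->; case/mapP: qB => j' _ ->.
by rewrite /= addr0 subr0.
Qed.

Lemma goodl_BR z d a e b : goodz z -> goodl (BR z d a e b).
Proof. by move=> gz; apply/allP => u /BR_zeta ->. Qed.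

Lemma scalable_BR n (z' z : int * int) d a e b (zz := z + z' *~ (d == n)%:R - z' *~ (e == n)%:R) :
  goodz zz -> large z = large zz -> scalable n z' (BR z d a e b).
Proof.
move=> gz lz; apply/allP => u /flattenP[l /mapP[t tl ->]] /allpairsP[[p q] /= [pA qB ->]] /=.
case/mapP: pA => j _ ->; case/mapP: qB => j' _ ->.
rewrite /shear /= !bdegD !(morphN (@bdegD _ _ n)) !bdegU /=.
rewrite (legs_torus (g := fun=> 0) (@bdegD _ _ n) _ _ tl) => [|k k'|u']; first last.
- by rewrite bdegU.
- by rewrite addr0.
rewrite oppr0 add0r addr0 subr0 mulrzBr addrA -/zz gz lz; exact: eqxx.
Qed.

Lemma scalable_flip n z' l : scalable n z' (flip l) = scalable n z' l.
Proof. exact: all_map. Qed.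

Lemma torusfix_vmap (fb : nat -> nat) : torusfix (vmap fb).
Proof. by []. Qed.

Lemma torusfix_rsplit d a : torusfix (@rsplit I E d a).
Proof. by []. Qed.

Lemma ren_vmap_BR (fb : nat -> nat) z d a e b :
  hmap (renP (vmap fb)) (BR z d a e b) = BR z (fb d) a (fb e) b.
Proof.
rewrite ren_BR; last exact: torusfix_vmap.
by apply: ER_eq => i; rewrite -map_comp; apply: eq_map => j; rewrite /renP /= mrenU.
Qed.

Lemma rsplit_blk d a b i :
  map (renP (rsplit d a)) (blk d (dvadd a b) i) = blk d a i ++ blk d.+1 b i.
Proof.
rewrite /blk /dvadd iotaD !map_cat add0n; congr (_ ++ _).
  rewrite -map_comp; apply/eq_in_map => j; rewrite mem_iota => /andP[_ ja].
  by rewrite /renP /= mrenU /= ltnn eqxx ja.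
rewrite -[in LHS](addn0 (a i)) iotaDl -!map_comp; apply: eq_map => j.
by rewrite /renP /= mrenU /= ltnn eqxx ltnNge leq_addr addKn.
Qed.

Lemma rsplit_blk_lt n d a b i : (d < n)%N -> map (renP (rsplit n a)) (blk d b i) = blk d b i.
Proof.
by move=> dn; rewrite -map_comp; apply: eq_map => j; rewrite /renP /= mrenU /= dn.
Qed.

Lemma rsplit_blk_gt n d a b i : (n < d)%N -> map (renP (rsplit n a)) (blk d b i) = blk d.+1 b i.
Proof.
move=> dn; rewrite -map_comp; apply: eq_map => j.
by rewrite /renP /= mrenU /= ltnNge (ltnW dn) /= gtn_eqF.
Qed.

(** The pull-back of Theta_{a+b,c} along the direct sum map is Theta_{a,c} Theta_{b,c}. Splitting
    block d pushes the later block e to e + 1. *)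
Lemma rsplit_BRl z d a b e c : (d < e)%N ->
  perm_eq (hmap (renP (rsplit d a)) (BR z d (dvadd a b) e c))
          (BR z d a e.+1 c ++ BR z d.+1 b e.+1 c).
Proof.
move=> de; rewrite ren_BR; last exact: torusfix_rsplit.
apply: perm_trans (ER_catl _ _ _ _).
by apply: ER_perm => i; rewrite ?rsplit_blk // rsplit_blk_gt.
Qed.

Lemma rsplit_BRr_lt z d a b e c : (e < d)%N ->
  perm_eq (hmap (renP (rsplit d a)) (BR z e c d (dvadd a b)))
          (BR z e c d a ++ BR z e c d.+1 b).
Proof.
move=> de; rewrite ren_BR; last exact: torusfix_rsplit.
apply: perm_trans (ER_catr _ _ _ _).
by apply: ER_perm => i; rewrite ?rsplit_blk // rsplit_blk_lt.
Qed.

Lemma rsplit_BRr_gt z d a b e c : (d < e)%N ->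
  perm_eq (hmap (renP (rsplit d a)) (BR z e c d (dvadd a b)))
          (BR z e.+1 c d a ++ BR z e.+1 c d.+1 b).
Proof.
move=> de; rewrite ren_BR; last exact: torusfix_rsplit.
apply: perm_trans (ER_catr _ _ _ _).
by apply: ER_perm => i; rewrite ?rsplit_blk // rsplit_blk_gt.
Qed.

(** The denominator of the braiding is kept as inverted factors at zeta^{-1}, since the prescribed
    expansion refers to that variable. *)
Definition SR z d b e a := BR z d b e a ++ flip (BR (- z) e a d b).

Lemma goodzN z : goodz (- z) = goodz z.
Proof.
case: z => u w; have -> : - (u, w) = (- u, - w) by [].
by rewrite /goodz !inE !xpair_eqE; lia.
Qed.

Lemma goodl_SR z d b e a : goodz z -> goodl (SR z d b e a).
Proof. by move=> gz; rewrite goodl_cat goodl_flip !goodl_BR // goodzN. Qed.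

Lemma YopLE : Yop src tgt kd = @YopL I E src tgt kd.
Proof. by rewrite YopL.unlock. Qed.

Lemma SopLE : Sop src tgt kd = @SopL I E src tgt kd.
Proof. by rewrite SopL.unlock. Qed.

Lemma Yop_nf d a b z l f x : goodz z -> goodl l -> scalable d z (hmap (renP (rsplit d a)) l) ->
  YopL src tgt kd d a b z (nf l f x) =
  nf (BR z d a d.+1 b ++ hmap (shear d z) (hmap (renP (rsplit d a)) l))
     (shear d z \o renP (rsplit d a) \o f) x.
Proof.
move=> gz gl sl; have gl' : goodl (hmap (renP (rsplit d a)) l) by rewrite goodl_ren.
rewrite YopL.unlock /Yop /Theta smulLE lam_glam Eroots_BR ren_nf // scale_nf // mul_nf //.
  exact: goodl_BR.
exact: goodl_shear.
Qed.

Lemma Sop_nf d a b z l f x : goodz z -> goodl l ->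
  SopL src tgt kd d a b z (nf l f x) =
  nf (SR z d b d.+1 a ++ hmap (renP (@rswap I E d)) l) (renP (@rswap I E d) \o f) x.
Proof.
move=> gz gl.
rewrite SopL.unlock /Sop /Sser smulLE !lam_glam.
have -> : [seq ((zinv z, u.1), u.2) | u <- negcl (Eroots src tgt kd a b d.+1 d)] =
          flip (BR (- z) d.+1 a d b).
  by rewrite -Eroots_BR /negcl /flip -!map_comp.
rewrite Eroots_BR -glam_cat ?goodl_flip ?goodl_BR ?goodzN // ren_nf // mul_nf //.
  exact: goodl_SR.
by rewrite goodl_ren.
Qed.

(** [shear_BR] applies to lists of the form [BR], and a split list is a concatenation of these only
    up to permutation; so the permutation is made before scaling. *)
Lemma Yop_nf_perm d a b z l l' f x : goodz z -> goodl l ->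
  perm_eq (hmap (renP (rsplit d a)) l) l' -> scalable d z l' ->
  YopL src tgt kd d a b z (nf l f x) =
  nf (BR z d a d.+1 b ++ hmap (shear d z) l') (shear d z \o renP (rsplit d a) \o f) x.
Proof.
move=> gz gl pl sl; have sl' : scalable d z (hmap (renP (rsplit d a)) l).
  by rewrite /scalable (perm_all _ pl).
rewrite Yop_nf //; apply: nf_eq => //; last by rewrite perm_cat2l perm_map.
by rewrite goodl_cat goodl_BR // goodl_shear.
Qed.

Lemma Yop_const d a b z x : goodz z -> YopL src tgt kd d a b z (sconst x) =
  nf (BR z d a d.+1 b) (shear d z \o renP (rsplit d a) \o @pinc I E) x.
Proof. by move=> gz; rewrite sconst_push -nf_nil Yop_nf //= cats0. Qed.

Lemma Sop_const d a b z x : goodz z -> SopL src tgt kd d a b z (sconst x) =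
  nf (SR z d b d.+1 a) (renP (@rswap I E d) \o @pinc I E) x.
Proof. by move=> gz; rewrite sconst_push -nf_nil Sop_nf //= cats0. Qed.

Lemma ER_nill z A B : (forall i, A i = [::]) -> ER z A B = [::].
Proof. by move=> A0; rewrite /ER; elim: legs => //= t u ->; rewrite A0. Qed.

Lemma ER_nilr z A B : (forall i, B i = [::]) -> ER z A B = [::].
Proof. by move=> B0; rewrite /ER; elim: legs => //= t u ->; rewrite B0 allpairs0r. Qed.

Lemma BR_dv0l z d e b : BR z d (dv0 (I := I)) e b = [::].
Proof. exact: ER_nill. Qed.

Lemma BR_dv0r z d a e : BR z d a e (dv0 (I := I)) = [::].
Proof. exact: ER_nilr. Qed.

Lemma SR_dv0 z d e a : SR z d (dv0 (I := I)) e a = [::].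
Proof. by rewrite /SR BR_dv0l BR_dv0r. Qed.

Lemma ren_vmap_SR (fb : nat -> nat) z d b e a :
  hmap (renP (vmap fb)) (SR z d b e a) = SR z (fb d) b (fb e) a.
Proof. by rewrite /SR hmap_cat hmap_flip !ren_vmap_BR. Qed.

End RootLists.


(** * Symmetric Laurent polynomials *)

Lemma msupp_lin (K K' : choiceType) (f : K -> {malg int[K']}) (x : {malg int[K]}) k :
  k \in msupp (lin f x) -> exists2 j, j \in msupp x & k \in msupp (f j).
Proof.
rewrite -mcoeff_neq0 coef_lin => nz; apply: Classical_Prop.NNPP => no; case/eqP: nz.
rewrite lin.unlock big_seq big1 // => j jx; rewrite mcoeff_outdom ?mul0rz //.
by apply/negP => kj; apply: no; exists j.
Qed.

Section Symmetric.
Variables I E : finType.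
Local Notation var := (var I E).
Local Notation mon := (mon I E).
Local Notation Lp := (Lp I E).
Implicit Types (r s : var -> var) (v : var) (k : mon) (x y : Lp) (a : I -> nat).

Definition supp_in (P : var -> bool) x :=
  forall k, k \in msupp x -> forall v, v \in msupp k -> P v.

Lemma Vt_supp ds x : Vt ds x -> supp_in (okvar ds) x.
Proof. by case. Qed.

Lemma Vt_sym ds x b i j j' : Vt ds x -> (b < size ds)%N ->
  (j < nth (fun=> 0%N) ds b i)%N -> (j' < nth (fun=> 0%N) ds b i)%N ->
  lrenL (swapidx b i j j') x = x.
Proof. by case=> _ h *; rewrite -lrenLE; apply: h. Qed.

Lemma VtP ds x : supp_in (okvar ds) x ->
  (forall b i j j', (b < size ds)%N ->
     (j < nth (fun=> 0%N) ds b i)%N -> (j' < nth (fun=> 0%N) ds b i)%N ->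
     lrenL (swapidx b i j j') x = x) -> Vt ds x.
Proof. by move=> h1 h2; split=> // *; rewrite lrenLE; apply: h2. Qed.

Lemma supp_in_lin (K : choiceType) P (f : K -> Lp) (y : {malg int[K]}) :
  (forall j, j \in msupp y -> supp_in P (f j)) -> supp_in P (lin f y).
Proof. by move=> h k /msupp_lin[j jy kj]; apply: (h j). Qed.

Lemma supp_inD P x y : supp_in P x -> supp_in P y -> supp_in P (x + y).
Proof.
move=> hx hy k; rewrite -mcoeff_neq0 mcoeffD => nz.
have [kx|nx] := boolP (k \in msupp x); first exact: hx.
by apply: hy; rewrite -mcoeff_neq0; move: nz; rewrite (mcoeff_outdom nx) add0r.
Qed.

Lemma supp_in0 P : supp_in P 0.
Proof. by move=> k; rewrite msupp0. Qed.

Lemma msuppU_mem (K : choiceType) (j k : K) : (k \in msupp (mU j)) = (k == j).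
Proof. by rewrite -mcoeff_neq0 mU_coef (eq_sym k); case: (j == k). Qed.

Lemma supp_in_lren (P Q : var -> bool) r x :
  supp_in P x -> (forall v, P v -> Q (r v)) -> supp_in Q (lrenL r x).
Proof.
move=> hx hr; rewrite lrenL.unlock; apply: supp_in_lin => k kx k'.
rewrite msuppU_mem => /eqP -> v; rewrite mrenL.unlock => /msupp_lin[u uk].
by rewrite msuppU_mem => /eqP ->; apply/hr/(hx k).
Qed.

Lemma lren_fix r x : (forall k, k \in msupp x -> forall v, v \in msupp k -> r v = v) ->
  lrenL r x = x.
Proof. by move=> h; rewrite (lren_eq_in (s := id)) // lren_id. Qed.

Lemma swapidxK b i j j' : involutive (@swapidx I E b i j j').
Proof.
move=> [u|[[b0 i0] j0]] //=.
case: ifP => [/andP[/eqP-> /eqP->]|/= ->//].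
have [->|n1] := eqVneq j0 j; first by rewrite /= !eqxx /=; have [->|] := eqVneq j' j.
have [->|n2] := eqVneq j0 j'; first by rewrite /= !eqxx.
by rewrite /= !eqxx /= (negbTE n1) (negbTE n2).
Qed.

(** A finite list, so that [seq_sub (okv a)] is a finite type on which moved variables can be
    counted and permutations taken. *)
Definition okv a : seq var := [seq sv E 0 i j | i <- enum I, j <- iota 0 (a i)].

Lemma mem_okv a v : (v \in okv a) = if v is inr (0%N, i, j) then (j < a i)%N else false.
Proof.
apply/allpairsPdep/idP => [[i [j [_ jn ->]]]|].
  by move: jn; rewrite mem_iota.
case: v => [//|[[[|//] i] j]] ja; exists i, j.
by rewrite mem_enum mem_iota.
Qed.

Lemma okvar1 a v : okvar [:: a] v = (if v is inl _ then true else v \in okv a).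
Proof.
by rewrite mem_okv; case: v => [//|[[[|b] i] j]].
Qed.

(** An injective self-map of the finitely many slots at each vertex, hence an arbitrary element of
    S(a). [Vt] itself provides only transpositions. *)
Definition slotwise a r := [/\ forall u, r (inl u) = inl u,
  forall i j, (j < a i)%N -> exists2 j', (j' < a i)%N & r (sv E 0 i j) = sv E 0 i j' &
  forall i j j', (j < a i)%N -> (j' < a i)%N -> r (sv E 0 i j) = r (sv E 0 i j') -> j = j'].

(* Composing with the transposition of v and r v fixes v without moving
   anything that was fixed, so the number of moved variables decreases. *)
Lemma lren_slotwise a r x : Vt [:: a] x -> slotwise a r -> lrenL r x = x.
Proof.
move=> hx; pose T := seq_sub (okv a).
have [n] := ubnP #|[set t : T | r (ssval t) != ssval t]|.
elim: n r => // n IH r lt_n [r0 r1 r2].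
have [h|[t]] := set_0Vmem [set t : T | r (ssval t) != ssval t].
  apply: lren_fix => k kx v vk; have := Vt_supp hx kx vk; rewrite okvar1.
  case: v vk => [u _ _|w vk wo]; first exact: r0.
  have := in_set0 (SeqSub wo); rewrite -h inE /= => /negbT; rewrite negbK; exact/eqP.
rewrite inE => mv; have := ssvalP t; rewrite mem_okv.
case ev : (ssval t) => [//|[[[|//] i] j]] ja.
have [j1 j1a e1] := r1 i j ja.
have nj : j1 != j by apply: contraNneq mv => e; rewrite ev e1 e.
pose tau := @swapidx I E 0 i j j1.
have tauE i' j' : tau (sv E 0 i' j') =
    if i' == i then (if j' == j then sv E 0 i j1 else if j' == j1 then sv E 0 i j else sv E 0 i' j')
    else sv E 0 i' j' by [].
have sl : slotwise a (tau \o r).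
  split=> [u|i' j' ja'|i' j' j'' ja' ja'' /= /(can_inj (@swapidxK 0 i j j1))].
  - by rewrite /= r0.
  - have [j2 j2a e2] := r1 i' j' ja'; rewrite /= e2 tauE.
    have [ei|ni] := eqVneq i' i; last by exists j2.
    rewrite ei in j2a *; case: ifP => _; first by exists j1.
    by case: ifP => _; [exists j | exists j2].
  - exact: r2.
have mu : (#|[set t0 : T | (tau \o r) (ssval t0) != ssval t0]| < n)%N.
  rewrite ltnS in lt_n; apply: leq_trans lt_n; apply: proper_card; apply/properP; split.
    apply/subsetP => t'; rewrite !inE; apply: contraNneq => fx.
    have := ssvalP t'; rewrite mem_okv; case ev' : (ssval t') fx => [//|[[[|//] i'] j']] fx ja' /=.
    rewrite fx tauE; have [ei|//] := eqVneq i' i; rewrite ei in fx ja' *.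
    have [ej|_] := eqVneq j' j.
      by move: mv; rewrite ev -ej fx eqxx.
    have [ej|//] := eqVneq j' j1.
    (* If [r] fixed slot j1, injectivity would force j = j1, because [r] also sends slot j to j1. *)
    have ejj : j' = j by apply: (r2 i) => //; rewrite fx e1 ej.
    by move: nj; rewrite -ej ejj eqxx.
  exists t; first by rewrite inE.
  by rewrite inE negbK ev /= -[inr _]/(sv E 0 i j) e1 tauE !eqxx (negbTE nj).
have := IH _ mu sl; rewrite -lren_comp => e.
have tx : lrenL tau x = x by apply: (Vt_sym hx).
have inv y : lrenL tau (lrenL tau y) = y.
  by rewrite lren_comp (lren_eq_in (s := id)) ?lren_id // => k _ v _; apply: swapidxK.
by rewrite -[LHS]inv e tx.
Qed.

(** * Symmetrisation over the product of symmetric groups *)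

Definition vtx v : option I := if v is inr (_, i, _) then Some i else None.

Definition perms a : {set {perm seq_sub (okv a)}} :=
  [set sg : {perm seq_sub (okv a)} | [forall t, vtx (ssval (sg t)) == vtx (ssval t)]].

Definition rho a (sg : {perm seq_sub (okv a)}) v : var :=
  if insub v is Some t then ssval (sg t) else v.

Lemma rho_in a (sg : {perm seq_sub (okv a)}) (t : seq_sub (okv a)) :
  rho sg (ssval t) = ssval (sg t).
Proof. by rewrite /rho -[ssval t]/(val t) valK. Qed.

Lemma rho_out a (sg : {perm seq_sub (okv a)}) v : v \notin okv a -> rho sg v = v.
Proof. by move=> nv; rewrite /rho insubN. Qed.

Lemma rho_comp a (sg tau : {perm seq_sub (okv a)}) v : rho tau (rho sg v) = rho (sg * tau)%g v.
Proof.
have [vo|nv] := boolP (v \in okv a); last by rewrite !rho_out.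
by rewrite -[v]/(ssval (SeqSub vo)) !rho_in permM.
Qed.

Lemma rho_tperm a i j j' (h : sv E 0 i j \in okv a) (h' : sv E 0 i j' \in okv a) v :
  rho (tperm (SeqSub h) (SeqSub h')) v = swapidx 0 i j j' v.
Proof.
have [vo|nv] := boolP (v \in okv a).
  rewrite -{1}[v]/(ssval (SeqSub vo)) rho_in.
  case: tpermP => [[->]|[->]|n1 n2] /=.
  - by rewrite !eqxx.
  - by rewrite !eqxx; have [->|] := eqVneq j' j.
  have {}n1 : v <> sv E 0 i j by move=> e; apply: n1; apply: val_inj.
  have {}n2 : v <> sv E 0 i j' by move=> e; apply: n2; apply: val_inj.
  case: v {vo} n1 n2 => [//|[[b0 i0] j0]] n1 n2 /=.
  case: eqP => //= eb; case: eqP => //= ei; rewrite eb ei in n1 n2 *.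
  by case: eqP => [ej|_]; [rewrite ej in n1 | case: eqP => [ej|//]; rewrite ej in n2].
rewrite rho_out //; case: v nv => [//|[[b0 i0] j0]] nv /=.
case: eqP => //= eb; case: eqP => //= ei; rewrite eb ei in nv *.
by case: eqP => [ej|_]; [rewrite ej h in nv | case: eqP => [ej|//]; rewrite ej h' in nv].
Qed.

Lemma slotwise_rho a (sg : {perm seq_sub (okv a)}) : sg \in perms a -> slotwise a (rho sg).
Proof.
rewrite inE => /forallP hv; split=> [u|i j ja|i j j' ja ja'].
- by rewrite rho_out // mem_okv.
- have ho : sv E 0 i j \in okv a by rewrite mem_okv.
  have /eqP := hv (SeqSub ho); rewrite -[sv E 0 i j]/(ssval (SeqSub ho)) rho_in.
  have := ssvalP (sg (SeqSub ho)); rewrite mem_okv.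
  by case: (ssval (sg _)) => [//|[[[|//] i'] j']] ja' [ei]; exists j'; rewrite ?ei // -ei.
have ho : sv E 0 i j \in okv a by rewrite mem_okv.
have ho' : sv E 0 i j' \in okv a by rewrite mem_okv.
rewrite -[sv E 0 i j]/(ssval (SeqSub ho)) -[sv E 0 i j']/(ssval (SeqSub ho')) !rho_in.
by move=> /val_inj /perm_inj [].
Qed.

(** Not divided by the order of the group, since the coefficients are integers. *)
Definition symz a x : Lp := \sum_(sg in perms a) lrenL (rho sg) x.

Lemma symzD a : {morph symz a : x y / x + y}.
Proof.
by move=> x y; rewrite /symz -big_split; apply: eq_bigr => sg _; rewrite lrenD.
Qed.

Lemma symz_fix a x : Vt [:: a] x -> symz a x = x *+ #|perms a|.
Proof.
move=> hx; rewrite /symz -sumr_const; apply: eq_bigr => sg hs.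
exact: (lren_slotwise hx (slotwise_rho hs)).
Qed.

Lemma perms_gt0 a : (0 < #|perms a|)%N.
Proof. by apply/card_gt0P; exists 1%g; rewrite inE; apply/forallP => t; rewrite perm1. Qed.

Lemma symz_Vt a x : supp_in (okvar [:: a]) x -> Vt [:: a] (symz a x).
Proof.
move=> hx; apply: VtP => [|[|//] i j j' _ /= ja ja'].
  rewrite /symz; apply: big_ind => [|y z|sg hs]; first exact: supp_in0.
    exact: supp_inD.
  apply: (supp_in_lren hx) => v; rewrite !okvar1.
  have [r0 r1 _] := slotwise_rho hs.
  case: v => [u _|w]; first by rewrite r0.
  rewrite mem_okv; case: w => -[[|//] i] j ja; have [j' ja' ->] := r1 i j ja.
  by rewrite /= mem_okv.
have ho : sv E 0 i j \in okv a by rewrite mem_okv.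
have ho' : sv E 0 i j' \in okv a by rewrite mem_okv.
pose tau := tperm (SeqSub ho) (SeqSub ho').
rewrite /symz (big_morph _ (lrenD _) (morph0 (lrenD _))).
(* The transposition acts on the group by right multiplication and so permutes the summands. *)
rewrite [RHS](reindex_inj (mulIg tau)); apply: eq_big => [sg|sg _]; last first.
  rewrite lren_comp; apply: lren_eq_in => k _ v _ /=.
  by rewrite -rho_comp rho_tperm.
rewrite !inE; apply: eq_forallb => t; rewrite permM; congr (_ == _).
by case: tpermP => [->|->|//].
Qed.

Definition torus v : bool := if v is inl _ then true else false.

Lemma kT_supp x : kT x <-> supp_in torus x.
Proof.
split=> [[h _] k kx v vk|h]; first by have := h k kx v vk; case: v {vk} => [//|[[b i] j]].
by apply: VtP => // k kx v vk; have := h k kx v vk; case: v {vk}.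
Qed.

Lemma lren_torus r x : (forall u, r (inl u) = inl u) -> supp_in torus x -> lrenL r x = x.
Proof.
by move=> hr hx; apply: lren_fix => k kx v vk; have := hx k kx v vk; case: v {vk}.
Qed.

Lemma symz_lmul a x y : supp_in torus x -> symz a (lmulL x y) = lmulL x (symz a y).
Proof.
move=> hx; rewrite /symz (big_morph _ (lmulDr x) (lmulr0 x)); apply: eq_bigr => sg _.
by rewrite lren_lmul (lren_torus _ hx) // => u; rewrite rho_out // mem_okv.
Qed.

End Symmetric.

(** * Tensor products of functionals *)

Section TensorFunctionals.
Variables I E : finType.
Local Notation var := (var I E).
Local Notation mon := (mon I E).
Local Notation Lp := (Lp I E).
Implicit Types (v : var) (k : mon) (x y : Lp) (a : I -> nat) (f g h : Lp -> Lp).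

Lemma supp_inU (P : var -> bool) k : (forall v, v \in msupp k -> P v) -> supp_in P (mU k : Lp).
Proof. by move=> hk k'; rewrite msuppU_mem => /eqP ->. Qed.

Lemma supp_inz (P : var -> bool) x c : supp_in P x -> supp_in P (x *~ c).
Proof.
move=> hx k; rewrite -mcoeff_neq0 mulz_coef mulf_eq0 negb_or => /andP[kx _].
by apply: hx; rewrite -mcoeff_neq0.
Qed.

Lemma Vt0 ds : Vt ds (0 : Lp).
Proof. by apply: VtP => [|*]; [exact: supp_in0 | exact: (morph0 (lrenD _))]. Qed.

Section OneFunctional.
Variables (a : I -> nat) (f : Lp -> Lp).
Hypothesis lf : Defs.linfun a f.

Lemma linfunD x y : Vt [:: a] x -> Vt [:: a] y -> f (x + y) = f x + f y.
Proof.
case: lf => _ + hx hy => /(_ (mU 0) x y); rewrite lmulLE !lmul1; apply=> //.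
by apply/kT_supp/supp_inU => v; rewrite msupp0.
Qed.

Lemma linfun0 : f 0 = 0.
Proof. by apply: (@addIr _ (f 0)); rewrite -linfunD ?add0r //; apply: Vt0. Qed.

Lemma linfunZ x y : supp_in (@torus I E) x -> Vt [:: a] y -> f (lmulL x y) = lmulL x (f y).
Proof.
move=> hx hy; case: lf => _ /(_ x y 0); rewrite lmulLE linfun0 !addr0; apply=> //.
  exact/kT_supp.
exact: Vt0.
Qed.

Lemma linfunz x c : Vt [:: a] x -> f (x *~ c) = f x *~ c.
Proof.
have e y : y *~ c = lmulL (mU 0 *~ c) y by rewrite (morphz c (lmulDl y)) lmul1.
move=> hx; rewrite (e x) (e (f x)) linfunZ //; apply/supp_inz/supp_inU => v.
by rewrite msupp0.
Qed.

Definition hat x : Lp := lin (fun k => f (symz a (mU k))) x.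

(** Additivity of [f] is given on symmetric polynomials only. The induction therefore adds up
    symmetrised monomials of x, each of which is symmetric. *)
Lemma hatE x : Vt [:: a] x -> hat x = f x *+ #|perms E a|.
Proof.
move=> hx.
have aux (s : seq mon) (c : mon -> int) :
    {subset s <= msupp x} ->
    supp_in (okvar [:: a]) (\sum_(k <- s) mU k *~ c k) /\
    f (symz a (\sum_(k <- s) mU k *~ c k)) = \sum_(k <- s) f (symz a (mU k)) *~ c k.
  elim: s => [_|k s IH hs]; rewrite ?big_nil ?big_cons.
    by rewrite (morph0 (@symzD _ _ a)) linfun0; split=> //; exact: supp_in0.
  have [|hs1 hs2] := IH; first by move=> k' k's; apply: hs; rewrite inE k's orbT.
  have kx : supp_in (okvar [:: a]) (mU k).
    by apply: supp_inU; apply: (Vt_supp hx); apply: hs; rewrite inE eqxx.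
  have kcx := @supp_inz _ _ (c k) kx; split; first exact: supp_inD.
  rewrite symzD linfunD ?hs2; try exact: symz_Vt.
  by congr (_ + _); rewrite (morphz _ (@symzD _ _ a)) linfunz //; apply: symz_Vt.
have [_] := aux (msupp x) (fun k => x@_k) (fun _ => id).
have -> : \sum_(k <- msupp x) mU k *~ x@_k = x by rewrite -[RHS]lin_malg lin.unlock.
rewrite symz_fix // pmulrn linfunz // -pmulrn => ->.
by rewrite /hat lin.unlock.
Qed.

Definition torpart k : mon := lin (fun v => if torus v then mU v else 0) k.
(** The part in block n is moved back to block 0, where a functional on one tensor factor expects
    its variables. *)
Definition blkpart n k : mon :=
  lin (fun v => if isblk n v then mU (vmap (fun=> 0%N) v) else 0) k.

Lemma split_parts k : (forall v, v \in msupp k -> okvar [:: a] v) -> k = torpart k + blkpart 0 k.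
Proof.
move=> hk; apply: (@morph_eq_in _ _ id (fun k => torpart k + blkpart 0 k)) => // [k1 k2|v /hk].
  by rewrite /torpart /blkpart !linD addrACA.
rewrite /torpart /blkpart !lin1 okvar1 mem_okv.
by case: v => [u _|[[[|//] i] j] _]; rewrite /= ?addr0 ?add0r.
Qed.

Lemma supp_torpart k v : v \in msupp (torpart k) -> torus v.
Proof.
move=> /msupp_lin[u _]; case tu: (torus u); last by rewrite msupp0.
by rewrite msuppU_mem => /eqP ->.
Qed.

Lemma supp_blkpart k v : (forall v, v \in msupp k -> okvar [:: a] v) ->
  v \in msupp (blkpart 0 k) -> okvar [:: a] v.
Proof.
move=> hk /msupp_lin[u /hk]; case tu: (isblk 0 u); last by rewrite msupp0.
rewrite msuppU_mem okvar1 mem_okv => + /eqP ->; rewrite okvar1.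
by case: u tu => [//|[[[|//] i] j]] /= _; rewrite mem_okv.
Qed.

(** In a tensor product over [kT] the torus part of a monomial belongs to no particular factor. Once
    it is pulled out of all three functionals, their product depends only on the product
    monomial. *)
Lemma linfun_parts k : (forall v, v \in msupp k -> okvar [:: a] v) ->
  f (symz a (mU k)) = lmulL (mU (torpart k)) (f (symz a (mU (blkpart 0 k)))).
Proof.
move=> hk; rewrite {1}(split_parts hk) -lmulUU symz_lmul; last exact/supp_inU/supp_torpart.
rewrite linfunZ //; first exact/supp_inU/supp_torpart.
by apply/symz_Vt/supp_inU => v; apply: supp_blkpart.
Qed.

Lemma torpart_up n k : (forall v, v \in msupp k -> okvar [:: a] v) ->
  torpart (mrenL (@up I E n) k) = torpart k.
Proof.
move=> hk; apply: (@morph_eq_in _ _ (fun k => torpart (mrenL (@up I E n) k))) => [k1 k2|k1 k2|v _].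
- by rewrite mrenD /torpart linD.
- by rewrite /torpart linD.
- by rewrite mrenU /torpart !lin1; case: v => [//|[[b i] j]].
Qed.

Lemma blkpart_up n m k : (forall v, v \in msupp k -> okvar [:: a] v) ->
  blkpart n (mrenL (@up I E m) k) = if n == m then blkpart 0 k else 0.
Proof.
move=> hk; apply: (@morph_eq_in _ _ (fun k => blkpart n (mrenL (@up I E m) k))
  (fun k => if n == m then blkpart 0 k else 0)) => [k1 k2|k1 k2|v /hk].
- by rewrite mrenD /blkpart linD.
- by case: (n == m); rewrite ?addr0 // /blkpart linD.
- rewrite mrenU /blkpart !lin1 okvar1 mem_okv eq_sym.
  by case: v => [//|[[[|//] i] j]] _ /=; rewrite ?add0n //; case: (_ == _).
Qed.

End OneFunctional.

(* A functional on symmetric polynomials extends, by symmetrisation, to all polynomials up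
   to the factor #|perms|. There the tensor product of the three extensions is defined on
   monomials, hence kills every decomposition of 0; the factor is cancelled at the end. *)
Lemma tens3_0 a1 a2 a3 f g h :
  Defs.linfun a1 f -> Defs.linfun a2 g -> Defs.linfun a3 h -> tens3 a1 a2 a3 f g h 0 = 0.
Proof.
move=> lf lg lh; rewrite /tens3; set t := epsilon _ _.
have [tV t0] : decomp3 a1 a2 a3 0 t.
  by apply: epsilon_spec; exists [::]; split=> //; rewrite big_nil.
pose L : Lp -> Lp := lin (fun k => lmulL (mU (torpart k))
  (lmulL (f (symz a1 (mU (blkpart 0 k))))
  (lmulL (g (symz a2 (mU (blkpart 1 k)))) (h (symz a3 (mU (blkpart 2 k))))))).
have LD : {morph L : x y / x + y} by exact: linD.
have LE u1 u2 u3 : Vt [:: a1] u1 -> Vt [:: a2] u2 -> Vt [:: a3] u3 ->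
    L (lmulL u1 (lmulL (lrenL (@up I E 1) u2) (lrenL (@up I E 2) u3))) =
    lmulL (hat a1 f u1) (lmulL (hat a2 g u2) (hat a3 h u3)).
  move=> V1 V2 V3.
  pose F x1 x2 x3 := L (lmulL x1 (lmulL (lrenL (@up I E 1) x2) (lrenL (@up I E 2) x3))).
  pose G x1 x2 x3 := lmulL (hat a1 f x1) (lmulL (hat a2 g x2) (hat a3 h x3)).
  rewrite -/(F u1 u2 u3) -/(G u1 u2 u3).
  apply: (@morph_eq_in _ _ (fun x => F x u2 u3) (fun x => G x u2 u3)) => [x y|x y|k1 k1x].
  - by rewrite /F lmulDl LD.
  - by rewrite /G /hat linD lmulDl.
  apply: (@morph_eq_in _ _ (fun x => F _ x u3) (fun x => G _ x u3)) => [x y|x y|k2 k2x].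
  - by rewrite /F lrenD lmulDl lmulDr LD.
  - by rewrite /G /hat linD lmulDl lmulDr.
  apply: (@morph_eq_in _ _ (F _ _) (G _ _)) => [x y|x y|k3 k3x].
  - by rewrite /F lrenD !lmulDr LD.
  - by rewrite /G /hat linD !lmulDr.
  have o1 := Vt_supp V1 k1x; have o2 := Vt_supp V2 k2x; have o3 := Vt_supp V3 k3x.
  (* The unshifted first factor is written as a shift by 0, so that the same lemmas compute the
     parts of all three. *)
  have up0 : mrenL (@up I E 0) k1 = k1.
    rewrite -[RHS]mren_id; apply: mren_eq_in => -[//|[[b i] j]] _.
    by rewrite /up /= addn0.
  rewrite /F /G /hat /L !lrenU !lmulUU !lin1 -{1 2 3 4}up0.
  have tD k k' : torpart (k + k') = torpart k + torpart k' by exact: linD.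
  have bD n k k' : blkpart n (k + k') = blkpart n k + blkpart n k' by exact: linD.
  rewrite !tD !bD (torpart_up _ o1) (torpart_up _ o2) (torpart_up _ o3).
  rewrite !(blkpart_up _ _ o1) !(blkpart_up _ _ o2) !(blkpart_up _ _ o3) /= !addr0 !add0r.
  rewrite (linfun_parts lf o1) (linfun_parts lg o2) (linfun_parts lh o3).
  rewrite -!lmulUU -!lmulA; congr lmulL.
  set T2 := mU (torpart k2); set T3 := mU (torpart k3).
  rewrite ![in RHS](lmulCA _ T2) ; congr lmulL.
  by rewrite ![in RHS](lmulCA _ T3).
pose N := (#|perms E a1| * (#|perms E a2| * #|perms E a3|))%N.
have N0 : (0 < N)%N by rewrite /N !muln_gt0 !perms_gt0.
set S := \sum_(u <- t) _.
(* Integer coefficients have no torsion, so N can be cancelled; N times [S] is the value of [L] on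
   the decomposition [t] of 0. *)
suff SN : S *+ N = 0.
  apply/malgP => k; have := congr1 (mcoeff k) SN; rewrite mcoeffMn mcoeff0 => /eqP.
  by rewrite mulrn_eq0 eqn0Ngt N0 => /eqP.
rewrite -(morph0 LD) t0 (big_morph L LD (morph0 LD)) /S -sumrMnl.
apply: eq_big_seq => u /tV[V1 V2 V3]; rewrite lmulLE lrenLE LE //.
rewrite (hatE lf V1) (hatE lg V2) (hatE lh V3) !pmulrn.
rewrite (morphz _ (lmulDl _)) !(morphz _ (lmulDr _)) (morphz _ (lmulDl _)) (morphz _ (lmulDr _)).
by rewrite -!mulrzA /N !PoszM; congr (_ *~ _); lia.
Qed.

End TensorFunctionals.


(** * The vertex coalgebra axioms *)

Section VertexCoalgebra.
Variables (I E : finType) (src tgt : E -> I) (kd : kind).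
Local Notation var := (var I E).
Local Notation mon := (mon I E).
Local Notation Lp := (Lp I E).
Local Notation ser := (ser I E).
Local Notation pt := (int * int * mon)%type.
Local Notation BR := (BR src tgt kd).
Local Notation SR := (SR src tgt kd).
Implicit Types (r s : var -> var) (v : var) (k : mon) (x y : Lp) (z : int * int).
Implicit Types (p q : pt) (l : seq (pt * bool)) (f g : mon -> pt) (a b c : I -> nat).
Implicit Types (d e : nat) (X Y : ser).

Lemma pincD : {morph @pinc I E : k k' / k + k'}.
Proof. by move=> k k'; congr pair; rewrite /= addr0. Qed.

Lemma renP_var r z v : renP r (z, mU v) = (z, mU (r v)).
Proof. by rewrite /renP /= mrenU. Qed.

Lemma shear_var d z (w : int * int) v :
  shear d z (w, mU v) = (w + z *~ (isblk d v)%:R, mU v).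
Proof. by rewrite /shear /= bdegU. Qed.

Lemma ok_eq ds x f g : Vt ds x -> {morph f : k k' / k + k'} -> {morph g : k k' / k + k'} ->
  (forall v, okvar ds v -> f (mU v) = g (mU v)) -> forall k, k \in msupp x -> f k = g k.
Proof.
move=> hx fD gD e k kx; apply: morph_eq_in => // v vk; apply: e; exact: (Vt_supp hx kx).
Qed.

(* A polynomial fixed by this renaming involves only variables allowed by ds. *)
Definition killr ds v : var := if okvar ds v then v else hv I E.

Lemma Vt_ser ds X : renS (killr ds) X = X ->
  (forall d i j j', (d < size ds)%N -> (j < nth (fun=> 0%N) ds d i)%N ->
     (j' < nth (fun=> 0%N) ds d i)%N -> renS (swapidx d i j j') X = X) ->
  forall n m, Vt ds (X n m).
Proof.
move=> hk hs n m; apply: VtP => [|d i j j' hd hj hj'].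
  rewrite -hk renSE; apply: (@supp_in_lren _ _ xpredT) => // v _.
  by rewrite /killr; case: ifP.
by rewrite -renSE hs.
Qed.

(** Renaming by [r] permutes the roots and turns the substitution into itself preceded by [s], which
    x does not see. With r = [killr ds] this yields the support condition, with a transposition the
    symmetry. *)
Lemma nf_sym ds r s l f x : goodl l -> perm_eq (hmap (renP r) l) l -> Vt ds x ->
  lrenL s x = x -> {morph f : k k' / k + k'} ->
  (forall v, okvar ds v -> renP r (f (mU v)) = f (mU (s v))) ->
  renS r (nf l f x) = nf l f x.
Proof.
move=> gl pl hx sx fD e; rewrite ren_nf // -{2}sx.
rewrite /nf push_lren -/(nf _ _ _); apply: nf_eq => //; first by rewrite goodl_ren.
apply: (ok_eq hx) => [k k'|k k'|v /e ev] /=.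
- by rewrite fD renPD.
- by rewrite mrenD fD.
- by rewrite mrenU.
Qed.

Lemma ren_BR_perm r z d a e b : torusfix r ->
  (forall i, perm_eq (map (renP r) (blk E d a i)) (blk E d a i)) ->
  (forall i, perm_eq (map (renP r) (blk E e b i)) (blk E e b i)) ->
  perm_eq (hmap (renP r) (BR z d a e b)) (BR z d a e b).
Proof. by move=> hr h1 h2; rewrite ren_BR //; apply: ER_perm. Qed.

Lemma ren_SR_perm r z d a e b : torusfix r ->
  (forall i, perm_eq (map (renP r) (blk E d a i)) (blk E d a i)) ->
  (forall i, perm_eq (map (renP r) (blk E e b i)) (blk E e b i)) ->
  perm_eq (hmap (renP r) (SR z d a e b)) (SR z d a e b).
Proof.
move=> hr h1 h2; rewrite /SR hmap_cat hmap_flip; apply: perm_cat; first exact: ren_BR_perm.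
by apply: perm_map; apply: ren_BR_perm.
Qed.

Lemma kill_blk ds d i : (d < size ds)%N ->
  perm_eq (map (renP (killr ds)) (blk E d (nth (fun=> 0%N) ds d) i))
          (blk E d (nth (fun=> 0%N) ds d) i).
Proof.
move=> hd; rewrite -map_comp; have -> // : forall (u w : seq pt), u = w -> perm_eq u w.
  by move=> u w ->.
apply/eq_in_map => j; rewrite mem_iota => /andP[_ hj] /=.
by rewrite renP_var /killr /= hd hj.
Qed.

Lemma torusfix_kill ds : torusfix (killr ds).
Proof. by []. Qed.

Lemma torusfix_swap d i j j' : torusfix (@swapidx I E d i j j').
Proof. by []. Qed.

Lemma swap_blk d e i i' j j' c : (e = d -> j < c i)%N -> (e = d -> j' < c i)%N ->
  perm_eq (map (renP (swapidx d i j j')) (blk E e c i')) (blk E e c i').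
Proof.
move=> hj hj'; rewrite -map_comp.
have [/andP[/eqP ed /eqP ei]|ne] := boolP ((e == d) && (i' == i)); last first.
  have -> // : forall (u w : seq pt), u = w -> perm_eq u w by move=> u w ->.
  by apply: eq_map => j0; rewrite /= renP_var /= (negbTE ne).
move: (hj ed) (hj' ed) => {}hj {}hj'; rewrite ed ei /blk.
pose tr n := if n == j then j' else if n == j' then j else n.
have trK : involutive tr.
  move=> n; rewrite /tr; have [->|n1] := eqVneq n j.
    by rewrite eqxx; have [->|] := eqVneq j' j.
  by have [->|n2] := eqVneq n j'; rewrite ?eqxx // (negbTE n1) (negbTE n2).
have -> : [seq (renP (swapidx d i j j') \o (fun n => (0, mU (sv E d i n)))) n | n <- iota 0 (c i)] =
    [seq ((0, mU (sv E d i n)) : pt) | n <- map tr (iota 0 (c i))].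
  rewrite -map_comp; apply: eq_map => n; rewrite /= renP_var /= !eqxx /tr.
  by case: (n == j) => //; case: (n == j').
apply: perm_map; apply: uniq_perm; rewrite ?map_inj_uniq ?iota_uniq //; first exact: inv_inj.
have sub n : (n < c i)%N -> (tr n < c i)%N.
  by rewrite /tr; case: eqP => // _; case: eqP.
move=> n; rewrite mem_iota add0n /=; apply/mapP/idP => [[m + ->]|nc].
  by rewrite mem_iota; apply: sub.
by exists (tr n); rewrite ?trK // mem_iota; apply: sub.
Qed.

Lemma isblk_swap n d i j j' v : isblk n (swapidx d i j j' v) = isblk n v.
Proof.
case: v => [//|[[d0 i0] j0]] /=; case: ifP => // /andP[/eqP -> _].
by case: ifP => // _; case: ifP.
Qed.

Lemma ser1_smul X Y : bdd X -> bdd Y -> ser1 X -> ser1 Y -> ser1 (smulL X Y).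
Proof.
move=> bX bY hX hY n m m0; rewrite smul_fs; last exact: bdd_convolvable.
apply: fs0 => -[i j] /=; have [j0|j0] := eqVneq j 0; last by rewrite hX // lmul0r.
by rewrite hY ?lmulr0 // j0 subr0.
Qed.

Lemma ser1_glam l : goodl l -> all (fun u => u.1.1.2 == 0) l -> ser1 (glam l).
Proof.
elim: l => [_ _ n m m0|u l IH /= /andP[gu gl] /andP[/eqP u0 l0]] /=.
  by rewrite /sconst (negbTE m0) andbF.
apply: ser1_smul; [exact: bdd_fac | exact: bdd_glam | | exact: IH].
by move=> n m m0; rewrite fac_coefs // u0 !mulr0 (negbTE m0) andbF.
Qed.

Lemma ser1_nf l f x : goodl l -> all (fun u => u.1.1.2 == 0) l ->
  (forall k, k \in msupp x -> (f k).1.2 = 0) -> ser1 (nf l f x).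
Proof.
move=> gl l0 f0; apply: ser1_smul; [exact: bdd_glam | exact: bdd_push | exact: ser1_glam|].
move=> n m m0; apply: push0 => k /f0 fk; apply/eqP => e; move: m0.
by rewrite -fk e eqxx.
Qed.

Lemma all_BR0 z d a e b : z.2 = 0 -> all (fun u => u.1.1.2 == 0) (BR z d a e b).
Proof. by move=> z0; apply/allP => u /BR_zeta ->; rewrite z0. Qed.

Lemma nf_linear l f x y (u : Lp) : goodl l -> {morph f : k k' / k + k'} -> kT u ->
  (forall w, f (mU (inl w)) = pinc (mU (inl w))) ->
  nf l f (lmul u x + y) = sadd (sscal u (nf l f x)) (nf l f y).
Proof.
move=> gl fD ku fu.
have ke k : k \in msupp u -> f k = pinc k.
  apply: (ok_eq ku fD pincD) => v; case: v => [w _|[[b i] j]] //; exact: fu.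
have bg := bdd_glam gl; have bp := bdd_push f.
rewrite /nf lmulLE pushD push_lmul // !smul_sscal smulDr //; last first.
  by apply: bdd_smul; [exact: bdd_const | exact: bp].
congr sadd; have bu := bdd_const u.
by rewrite smulA // (smulC bg bu) -smulA.
Qed.

(** Equal series receive the same decomposition from [tens3]. Only boundedness needs an argument:
    where the series vanishes, [tens3_0] gives 0. *)
Lemma weq3_eq a b c X Y : bdd X -> X = Y -> weq3 a b c X Y.
Proof.
move=> bX <- f g h lf lg lh; suff bF : bdd (fun n m => tens3 a b c f g h (X n m)) by [].
by case: bX => N [M hX]; exists N, M => n m /hX ->; apply: tens3_0.
Qed.

End VertexCoalgebra.


(** * Verification of the individual axioms *)

Section Identities.
Variables (I E : finType) (src tgt : E -> I) (kd : kind).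
Local Notation var := (var I E).
Local Notation mon := (mon I E).
Local Notation BR := (BR src tgt kd).
Local Notation SR := (SR src tgt kd).
Local Notation pinc := (@pinc I E).

Ltac solve_morph := by move=> ? ? /=; rewrite ?(mrenD, pincD, renPD, shearD).

Lemma good_zZ : goodz zZ. Proof. by []. Qed.
Lemma good_zZi : goodz zZi. Proof. by []. Qed.
Lemma good_zW : goodz zW. Proof. by []. Qed.
Lemma good_zZW : goodz zZW. Proof. by []. Qed.
Hint Resolve good_zZ good_zZi good_zW good_zZW : core.

Lemma okvar_ind2 a b (P : var -> Prop) : (forall u, P (inl u)) ->
  (forall i j, (j < a i)%N -> P (sv E 0 i j)) -> (forall i j, (j < b i)%N -> P (sv E 1 i j)) ->
  forall v, okvar [:: a; b] v -> P v.
Proof. by move=> h0 h1 h2 [u|[[[|[|//]] i] j]] //= => [/h1|/h2]. Qed.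

Lemma okvar_ind1 a (P : var -> Prop) : (forall u, P (inl u)) ->
  (forall i j, (j < a i)%N -> P (sv E 0 i j)) -> forall v, okvar [:: a] v -> P v.
Proof. by move=> h0 h1 [u|[[[|//] i] j]] //= => /h1. Qed.

Lemma swap_rsplit0 a i j j' v : (j < a i)%N -> (j' < a i)%N ->
  swapidx 0 i j j' (rsplit 0 a v) = rsplit 0 a (swapidx 0 i j j' v) :> var.
Proof.
move=> hj hj'; case: v => [//|[[[|d0] i0] j0]] //=.
have [->|ni] := eqVneq i0 i; last first.
  by case: (ltnP j0 (a i0)) => h /=; rewrite ?(negbTE ni) //= ?h // ltnNge h.
have [->|n1] := eqVneq j0 j; first by rewrite hj /= !eqxx hj'.
have [->|n2] := eqVneq j0 j'; first by rewrite hj' /= !eqxx hj; case: eqP => // ->.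
case: (ltnP j0 (a i)) => h /=; first by rewrite !eqxx /= (negbTE n1) (negbTE n2) h.
by rewrite ltnNge h.
Qed.

Lemma swap_rsplit1 a i j j' v :
  swapidx 1 i j j' (rsplit 0 a v) = rsplit 0 a (swapidx 0 i (a i + j) (a i + j') v) :> var.
Proof.
case: v => [//|[[[|d0] i0] j0]] //=.
have [->|ni] := eqVneq i0 i; last first.
  by case: (ltnP j0 (a i0)) => h /=; rewrite ?(negbTE ni) //= ?h // ltnNge h.
case: (ltnP j0 (a i)) => h /=; rewrite ?eqxx /=.
  have /negbTE -> : (j0 != a i + j)%N by lia.
  have /negbTE -> : (j0 != a i + j')%N by lia.
  by rewrite /= h.
have -> : (j0 - a i == j)%N = (j0 == a i + j)%N by lia.
have -> : (j0 - a i == j')%N = (j0 == a i + j')%N by lia.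
case: (_ == _); first by rewrite /= ltnNge leq_addr addKn.
case: (_ == _); first by rewrite /= ltnNge leq_addr addKn.
by rewrite /= ltnNge h.
Qed.

Lemma Y_welldef_holds : Y_welldef src tgt kd.
Proof.
rewrite /Y_welldef YopLE => a b; split=> [x hx|r x y kr hx hy].
  set l := BR zZ 0 a 1 b.
  have gl : goodl l by exact: goodl_BR.
  rewrite Yop_const // -/l; set f := _ \o _.
  have fD : {morph f : k k' / k + k'} by rewrite /f; solve_morph.
  have fE v : f (mU v) = (zZ *~ (isblk 0 (rsplit 0 a v))%:R, mU (rsplit 0 a v)).
    by rewrite /f /= renP_var shear_var add0r.
  have supp (v : var) : okvar [:: dvadd a b] v -> okvar [:: a; b] (rsplit 0 a v).
    move: v; apply: (@okvar_ind1 (dvadd a b) (fun v => okvar [:: a; b] (rsplit 0 a v))) => [//|i j hj] /=.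
    by case: (ltnP j (a i)) => ja /=; [rewrite ja | rewrite ltn_subLR].
  split; first 1 last.
  - exact: bdd_nf.
  - apply: Vt_ser => [|d i j j' hd hj hj'].
      apply: (nf_sym (s := id) gl _ hx _ fD) => [||v /supp ok].
      + apply: ren_BR_perm => [||i]; first exact: torusfix_kill.
          by move=> i; apply: (@kill_blk _ _ [:: a; b] 0%N).
        exact: (@kill_blk _ _ [:: a; b] 1%N).
      + exact: lren_id.
      + by rewrite fE renP_var /killr ok.
    (* Slot j of block 1 comes from slot a_i + j of the block before splitting, while block 0 keeps
       its slots. *)
    pose o := (if d == 0 then 0 else a i)%N.
    apply: (nf_sym (s := swapidx 0 i (o + j) (o + j')) gl _ hx _ fD).
    + apply: ren_BR_perm => [||i']; first exact: torusfix_swap.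
        by move=> i'; apply: swap_blk => e0; rewrite -e0 in hj hj'.
      by apply: swap_blk => e0; rewrite -e0 in hj hj'.
    + apply: (Vt_sym hx) => //=; rewrite /o /dvadd.
        by case: d hd hj {hj' o} => [|[|//]] _ /= hj; rewrite ?ltn_add2l // ltn_addr.
      by case: d hd hj' {hj o} => [|[|//]] _ /= hj; rewrite ?ltn_add2l // ltn_addr.
    move=> v vo; rewrite !fE renP_var.
    have e : swapidx d i j j' (rsplit 0 a v) = rsplit 0 a (swapidx 0 i (o + j) (o + j') v).
      case: d @o hd hj hj' => [|[|//]] o _ /= hj hj'.
        exact: swap_rsplit0.
      exact: swap_rsplit1.
    by rewrite -e isblk_swap.
  - apply: ser1_nf => //; first exact: all_BR0.
    by move=> k _; rewrite /f /= pair_mulz /= mulr0 addr0.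
rewrite !Yop_const //; apply: nf_linear => //; first exact: goodl_BR.
  by solve_morph.
by move=> w; rewrite /= renP_var shear_var /= addr0.
Qed.

Lemma swap_rswap d i j j' v : (d < 2)%N ->
  swapidx d i j j' (rswap 0 v) = rswap 0 (swapidx (1 - d) i j j' v) :> var.
Proof.
case: d => [|[|//]] _; case: v => [//|[[[|[|d0]] i0] j0]] //=;
  by case: (i0 == i) => //=; case: (j0 == j) => //=; case: (j0 == j').
Qed.

Lemma S_welldef_holds : S_welldef src tgt kd.
Proof.
rewrite /S_welldef SopLE => a b; split=> [x hx|r x y kr hx hy].
  set l := SR zZ 0 b 1 a.
  have gl : goodl l by exact: goodl_SR.
  rewrite Sop_const // -/l; set f := _ \o _.
  have fD : {morph f : k k' / k + k'} by rewrite /f; solve_morph.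
  have fE v : f (mU v) = (0, mU (rswap 0 v)) by rewrite /f /= renP_var.
  have supp (v : var) : okvar [:: a; b] v -> okvar [:: b; a] (rswap 0 v).
    by move: v; apply: (@okvar_ind2 a b (fun v => okvar [:: b; a] (rswap 0 v))).
  split; first 1 last.
  - exact: bdd_nf.
  - apply: Vt_ser => [|d i j j' hd hj hj'].
      apply: (nf_sym (s := id) gl _ hx _ fD) => [||v /supp ok].
      + apply: ren_SR_perm => [||i]; first exact: torusfix_kill.
          by move=> i; apply: (@kill_blk _ _ [:: b; a] 0%N).
        exact: (@kill_blk _ _ [:: b; a] 1%N).
      + exact: lren_id.
      + by rewrite fE renP_var /killr ok.
    apply: (nf_sym (s := swapidx (1 - d) i j j') gl _ hx _ fD).
    + apply: ren_SR_perm => [||i']; first exact: torusfix_swap.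
        by move=> i'; apply: swap_blk => e0; rewrite -e0 in hj hj'.
      by apply: swap_blk => e0; rewrite -e0 in hj hj'.
    + by apply: (Vt_sym hx) => //=; case: d hd hj hj' => [|[|//]].
    by move=> v vo; rewrite !fE renP_var swap_rswap.
  - apply: ser1_nf => //; rewrite all_cat all_BR0 // all_map.
    by apply/allP => u /BR_zeta /= ->.
rewrite !Sop_const //; apply: nf_linear => //; first exact: goodl_SR.
  by solve_morph.
by move=> w; rewrite /= renP_var.
Qed.

Lemma Dop_const z x : Dop z (sconst x) = nf [::] (shear 0 z \o pinc) x.
Proof. by rewrite /Dop sconst_push -nf_nil scale_nf. Qed.

Lemma lpoly1_shear z x : z.2 = 0 -> lpoly1 (nf [::] (shear 0 z \o pinc) x).
Proof.
move=> z0; have [N hN] := seq_bound (fun k : mon => `|(shear 0 z (pinc k)).1.1|) (msupp x).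
exists N => n m h; rewrite nf_nil; apply: push0 => k kx; apply/eqP => e.
have := hN k kx; have : (shear 0 z (pinc k)).1.2 = 0 by rewrite /= pair_mulz z0 /= mulr0 addr0.
by rewrite e /=; lia.
Qed.

Lemma D_welldef_holds : D_welldef I E.
Proof.
move=> a; split=> [x hx|r x y kr hx hy].
  rewrite !Dop_const; split.
  - exact: lpoly1_shear.
  - have fD : {morph shear 0 zZ \o pinc : k k' / k + k'} by solve_morph.
    apply: Vt_ser => [|d i j j' hd hj hj'].
      apply: (nf_sym (s := id) _ _ hx _ fD) => // [|v ok]; first exact: lren_id.
      by rewrite /= shear_var renP_var /killr ok.
    apply: (nf_sym (s := swapidx d i j j') _ _ hx _ fD) => // [|v ok].
      exact: (Vt_sym hx).
    by rewrite /= !shear_var renP_var isblk_swap.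
  - rewrite /Dop scale_nf //; apply: nf_eq => // k _ /=.
    by congr pair; rewrite /= -addrA -mulrzDl.
rewrite !Dop_const; apply: nf_linear => //; first by solve_morph.
by move=> w; rewrite /= shear_var /= addr0.
Qed.

Ltac solve_perm := by apply/seq.permP => ?; rewrite ?(count_cat, hmap_cat, flip_cat) /=; lia.

Lemma S_unitary_holds : S_unitary src tgt kd.
Proof.
rewrite /S_unitary SopLE => a b x hx; rewrite Sop_const // Sop_nf ?goodl_SR // ren_vmap_SR /= /SR.
have -> : - zZi = zZ by [].
have -> : - zZ = zZi by [].
set L := BR zZi 0 a 1 b; set M := BR zZ 1 b 0 a.
have gL : goodl L by exact: goodl_BR.
have gM : goodl M by exact: goodl_BR.
(* After the swap, the numerator of each braiding is the denominator of the other at the same zeta,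
   hence in the same expansion. *)
rewrite (@nf_eq _ _ _ (L ++ flip L ++ M ++ flip M ++ [::]) _ pinc).
- by rewrite nf_cancel ?goodl_cat ?goodl_flip ?gM // nf_cancel // nf_nil sconst_push.
- by rewrite !goodl_cat !goodl_flip gL gM.
- solve_perm.
apply: (ok_eq hx); [solve_morph | exact: pincD |].
by apply: okvar_ind2 => *; rewrite /= !renP_var.
Qed.

Lemma covacuum_holds : covacuum src tgt kd.
Proof.
rewrite /covacuum YopLE SopLE; split=> [a x hx|]; last split=> a x hx.
- rewrite Yop_const // BR_dv0l /dropfirst ren_nf // sconst_push -[RHS]nf_nil.
  apply: nf_eq => //; apply: (ok_eq hx); [solve_morph | exact: pincD |].
  apply: okvar_ind1 => *; rewrite /= renP_var shear_var renP_var /= ?addr0 //.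
  by rewrite subn0.
- rewrite Yop_const // BR_dv0r.
  have -> : nf [::] (shear 0 zZ \o renP (rsplit 0 a) \o pinc) x = nf [::] (shear 0 zZ \o pinc) x.
    apply: nf_eq => //; apply: (ok_eq hx); try solve_morph.
    by apply: okvar_ind1 => [u|i j ja]; rewrite /= renP_var //= ja.
  split; first exact: lpoly1_shear.
  rewrite fsumE; apply/malgP => k; rewrite nf_nil.
  (* A monomial k of x occurs only at z^{deg k}, so summing over n, which sets z = 1, returns its
     coefficient. *)
  have hp n : (push (shear 0 zZ \o pinc) x n 0)@_k = if n == bdegL 0 k then x@_k else 0.
    rewrite -[LHS]/(cf _ (n, 0, k)) -[(n, 0, k)](@shearNK _ _ 0 zZ) scaled_push -sconst_push.
    rewrite /cf /shear /= pair_mulz /sconst /= mulr0 addr0 mulrN1 subr_eq0 eqxx andbT.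
    by case: (_ == _); rewrite ?mcoeff0.
  rewrite (fs_morph (@mcoeffD _ _ k)); last first.
    have [N hN] := seq_bound (fun k : mon => `|bdegL 0 k|) (msupp x).
    exists (irange (- N) N) => n nN; apply: push0 => k' kx; apply/eqP => /= e.
    move: nN; have := hN k' kx; rewrite pair_mulz in e; case: e => en.
    by move=> _ h; rewrite mem_irange //; lia.
  rewrite (@fs_single _ _ (bdegL 0 k)) /=; first by rewrite hp eqxx.
  by move=> n /negbTE nk; rewrite /= hp nk.
- rewrite Sop_const // SR_dv0 /dropfirst ren_nf // sconst_push -[RHS]nf_nil.
  apply: nf_eq => //; apply: (ok_eq hx); [solve_morph | exact: pincD |].
  by apply: okvar_ind2 => *; rewrite /= !renP_var.
Qed.

(* The two sides of skew symmetry split a + b as (a, b) and as (b, a); they agree only after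
   this rotation, which a symmetric polynomial does not see. *)
Definition rot a b (v : var) : var :=
  if v is inr (d, i, j) then sv E d i (if (j < a i)%N then b i + j else j - a i)%N else v.

Lemma slotwise_rot a b : slotwise (dvadd a b) (rot a b).
Proof.
split=> [//|i j|i j j']; rewrite /dvadd /rot /sv.
  move=> ja; exists (if (j < a i)%N then b i + j else j - a i)%N => //.
  by case: ifP; lia.
by move=> h1 h2 []; case: ifP; case: ifP; lia.
Qed.

Lemma skew_symmetry_holds : skew_symmetry src tgt kd.
Proof.
rewrite /skew_symmetry YopLE SopLE => a b x hx; rewrite Yop_const // Sop_nf ?goodl_BR // ren_vmap_BR /=.
rewrite Dop_const Yop_nf //= cats0 /SR.
have -> : - zZi = zZ by [].
set L := BR zZi 0 b 1 a; set M := BR zZ 1 a 0 b.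
have gL : goodl L by exact: goodl_BR.
have gM : goodl M by exact: goodl_BR.
pose g := (shear 0 zZi \o renP (rsplit 0 b)) \o (shear 0 zZ \o pinc); rewrite -/g.
(* [M] is the swapped numerator of Y_{a,b}(z) and [flip M] the denominator of the braiding, so
   Theta_{b,a}(z^{-1}) remains. On the right [D(z)] scales all variables and Y_{b,a}(z^{-1}) undoes
   this on the b part, leaving z on the a part as on the left. *)
rewrite (@nf_eq _ _ _ (M ++ flip M ++ L) _ (g \o mrenL (rot a b))); first last.
- apply: (ok_eq hx); rewrite /g; try solve_morph.
  apply: okvar_ind1 => [u|i j ja]; rewrite /= !(mrenU, renP_var, shear_var) /= ?addr0 //.
  move: ja; rewrite /dvadd; case: (ltnP j (a i)) => ja jab /=.
    by rewrite ltnNge leq_addr /= addKn bdegU.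
  by rewrite ltn_subLR // jab /= bdegU.
- solve_perm.
- by rewrite !goodl_cat !goodl_flip gL gM.
by rewrite nf_cancel // /nf -push_lren (lren_slotwise hx (slotwise_rot a b)).
Qed.

(** Both sides carry Theta_{a,b}(z) Theta_{a,c}(zw) Theta_{b,c}(w). On the left, scaling by z turns
    the a part of Theta_{a+b,c}(w) from w to zw; on the right, scaling the b factor by w turns the b
    part of Theta_{a,b+c}(zw) from zw to z. *)
Lemma weak_coassoc_holds : weak_coassoc src tgt kd.
Proof.
rewrite /weak_coassoc YopLE => a b c x hx.
have pl := rsplit_BRl src tgt kd zW a b c (ltn0Sn 0).
have pr := rsplit_BRr_lt src tgt kd zZW b c a (ltn0Sn 0).
rewrite !Yop_const // (Yop_nf_perm _ _ _ _ _ _ _ _ pl) ?goodl_BR //; last first.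
  by rewrite scalable_cat !scalable_BR.
rewrite (Yop_nf_perm _ _ _ _ _ _ _ _ pr) ?goodl_BR //; last first.
  by rewrite scalable_cat !scalable_BR.
rewrite !hmap_cat !shear_BR.
have gl z d e a' b' : goodz z -> goodl (BR z d a' e b') by exact: goodl_BR.
apply: weq3_eq; first by apply: bdd_nf; rewrite !goodl_cat !gl.
apply: nf_eq; first by rewrite !goodl_cat !gl.
  (* The shifted exponents, such as w + z and zw - w, are evaluated by conversion, so that matching
     lists become identical. *)
  rewrite -[perm_eq _ _]/(perm_eq (BR zZ 0 a 1 b ++ (BR zZW 0 a 2 c ++ BR zW 1 b 2 c))
                                  (BR zW 1 b 2 c ++ (BR zZ 0 a 1 b ++ BR zZW 0 a 2 c))).
  solve_perm.
apply: (ok_eq hx); try solve_morph.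
apply: okvar_ind1 => [u|i j ja]; rewrite /= !(renP_var, shear_var) //=.
rewrite /dvadd in ja *; case: (ltnP j (a i)) => h1 /=.
  by rewrite ltn_addr //= h1.
case: (ltnP j (a i + b i)) => h2 /=.
  have -> : (j < a i)%N = false by rewrite ltnNge h1.
  by rewrite ltn_subLR // h2.
have -> : (j - a i < b i)%N = false by rewrite ltn_subLR // ltnNge h2.
by rewrite /= subnDA.
Qed.

(** Braidings only rename the blocks of earlier roots, so both sides carry S_{b,a}(w) S_{c,a}(zw)
    S_{c,b}(z) and reverse the order of the three blocks. *)
Lemma yang_baxter_holds : yang_baxter src tgt kd.
Proof.
rewrite /yang_baxter SopLE => a b c x hx.
have gl z d e a' b' : goodz z -> goodl (SR z d a' e b') by exact: goodl_SR.
rewrite !Sop_const // !Sop_nf ?gl //; first last.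
- by rewrite goodl_cat goodl_ren !gl.
- by rewrite goodl_cat goodl_ren !gl.
rewrite /SR !(hmap_cat, hmap_flip, ren_vmap_BR) /=.
have gb z d e a' b' : goodz z -> goodl (BR z d a' e b') by exact: goodl_BR.
apply: weq3_eq; first by apply: bdd_nf; rewrite !(goodl_cat, goodl_flip) !gb.
apply: nf_eq; [by rewrite !(goodl_cat, goodl_flip) !gb | solve_perm |].
apply: (ok_eq hx); try solve_morph.
by move=> [u|[[[|[|[|//]]] i] j]] _; rewrite /= !renP_var.
Qed.

(** Scaling the d1 part of S_{d1+d2,g}(w) by z moves its numerators from w to zw and its
    denominators from w^{-1} to (zw)^{-1}, each staying at its end of the expansion. The result is
    S_{d1,g}(zw) S_{d2,g}(w), the two braidings on the right. *)
Lemma yang_baxter_Y_holds : yang_baxter_Y src tgt kd.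
Proof.
rewrite /yang_baxter_Y YopLE SopLE => g d1 d2 x hx.
have gb z d e a' b' : goodz z -> goodl (BR z d a' e b') by exact: goodl_BR.
have gs z d e a' b' : goodz z -> goodl (SR z d a' e b') by exact: goodl_SR.
have p1 := rsplit_BRl src tgt kd zW d1 d2 g (ltn0Sn 0).
have p2 := rsplit_BRr_gt src tgt kd (- zW) d1 d2 g (ltn0Sn 0).
have pl : perm_eq (hmap (renP (rsplit 0 d1)) (SR zW 0 (dvadd d1 d2) 1 g))
   ((BR zW 0 d1 2 g ++ BR zW 1 d2 2 g) ++
    flip (BR (- zW) 2 g 0 d1 ++ BR (- zW) 2 g 1 d2)).
  by rewrite /SR hmap_cat hmap_flip; apply: perm_cat => //; apply: perm_map.
rewrite Sop_const // (Yop_nf_perm _ _ _ _ _ _ _ _ pl) ?gs //; last first.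
  by rewrite !scalable_cat scalable_flip scalable_cat !scalable_BR.
rewrite Yop_const // !Sop_nf ?gb //; last by rewrite goodl_cat gs // goodl_ren gb.
rewrite /SR !(flip_cat, hmap_cat, hmap_flip, shear_BR, ren_vmap_BR) /=.
apply: weq3_eq; first by apply: bdd_nf; rewrite !(goodl_cat, goodl_flip) !gb.
apply: nf_eq; first by rewrite !(goodl_cat, goodl_flip) !gb.
  rewrite -[perm_eq _ _]/(perm_eq (BR zZ 0 d1 1 d2 ++ (BR zZW 0 d1 2 g ++ BR zW 1 d2 2 g) ++
    flip (BR (- zZW) 2 g 0 d1) ++ flip (BR (- zW) 2 g 1 d2)) _).
  solve_perm.
apply: (ok_eq hx); try solve_morph.
apply: okvar_ind2 => [u|i j ja|i j ja]; rewrite /= !(renP_var, shear_var) //=.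
by case: (ltnP j (d1 i)) => h1 /=.
Qed.

End Identities.

Theorem theorem3p2p6 (I E : finType) (src tgt : E -> I) (kd : kind) :
  braided_mult_vertex_coalgebra src tgt kd.
Proof.
split; first exact: Y_welldef_holds.
split; first exact: S_welldef_holds.
split; first exact: D_welldef_holds.
split; first exact: S_unitary_holds.
split; first exact: covacuum_holds.
split; first exact: skew_symmetry_holds.
split; first exact: weak_coassoc_holds.
split; first exact: yang_baxter_holds.
exact: yang_baxter_Y_holds.
Qed.
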